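(* Let $N\ge1$ be an integer and $\mathbf{k}$ a commutative $\mathbb{Q}$-algebra. There exist a topological $\mathbf{k}$-algebra morphism $\widehat\Delta^{\mathcal W,\mathrm B}_N:\widehat{\mathcal W}^{\mathrm B}_N\to(\widehat{\mathcal W}^{\mathrm B}_N)^{\hat\otimes2}$ and a topological $\mathbf{k}$-module morphism $\widehat\Delta^{\mathcal M,\mathrm B}_N:\widehat{\mathcal M}^{\mathrm B}_N\to(\widehat{\mathcal M}^{\mathrm B}_N)^{\hat\otimes2}$ that endow $\widehat{\mathcal W}^{\mathrm B}_N$ and $\widehat{\mathcal M}^{\mathrm B}_N$ respectively with compatible (topological) Hopf algebra and coalgebra structures.
   Context: **Betti objects.** $F_2$ is the free group on $X_0,X_1$ and $\mu_N\subset\mathbb{C}^\times$ the group of $N$-th roots of unity. $\mathcal V^{\mathrm B}_N:=\mathbf{k}F_2$ is the group algebra with the filtration $\mathcal F^m\mathcal V^{\mathrm B}_N=\mathcal I^m$ ($m\ge0$, $\mathcal I^0=\mathbf{k}F_2$), where $\mathcal I=\ker(\mathbf{k}F_2\to\mathbf{k}\mu_N)$ is the kernel of the algebra morphism induced by $X_0\mapsto e^{2\pi i/N}$, $X_1\mapsto1$; $\widehat{\mathcal V}^{\mathrm B}_N:=\varprojlim\mathcal V^{\mathrm B}_N/\mathcal F^m\mathcal V^{\mathrm B}_N$. $\mathcal W^{\mathrm B}_N:=\mathbf{k}\oplus\mathcal V^{\mathrm B}_N(X_1-1)$ is a subalgebra, filtered by $\mathcal F^m\mathcal W^{\mathrm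 B}_N=\mathcal W^{\mathrm B}_N\cap\mathcal F^m\mathcal V^{\mathrm B}_N$, and $\widehat{\mathcal W}^{\mathrm B}_N:=\varprojlim\mathcal W^{\mathrm B}_N/\mathcal F^m\mathcal W^{\mathrm B}_N$. $\mathcal M^{\mathrm B}_N:=\mathcal V^{\mathrm B}_N/\mathcal V^{\mathrm B}_N(X_0-1)$, with $1_{\mathrm B}$ the class of $1$, is filtered by $\mathcal F^m\mathcal M^{\mathrm B}_N=\mathcal F^m\mathcal W^{\mathrm B}_N\cdot1_{\mathrm B}$, and $\widehat{\mathcal M}^{\mathrm B}_N:=\varprojlim\mathcal M^{\mathrm B}_N/\mathcal F^m\mathcal M^{\mathrm B}_N$, which is a $\widehat{\mathcal W}^{\mathrm B}_N$-module. **Conventions.** Topological $\mathbf{k}$-modules are $\mathbf{k}$-modules with a decreasing filtration for which they are complete and separated; $\hat\otimes$ is the completed tensor product. Topological algebras, coalgebras, Hopf algebras are the corresponding objects in this symmetric tensor category; coalgebras are coassociative and cocommutative. Compatible means that $\widehat\Delta^{\mathcal M,\mathrm B}_N(am)=\widehat\Delta^{\mathcal W,\mathrm B}_N(a)\,\widehat\Delta^{\mathcal M,\mathrm B}_N(m)$ for all $a\in\widehat{\mathcal W}^{\mathrm B}_N$, $m\in\widehat{\mathcal M}^{\mathrm B}_N$. *)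

(* Defs.v *)
From HB Require Import structures.
From mathcomp Require Import all_boot all_order all_algebra finmap.
From mathcomp Require Import boolp classical_sets Rstruct reals trigo complex.

Set Implicit Arguments.
Unset Strict Implicit.
Unset Printing Implicit Defensive.

Import GRing.Theory Num.Theory.
Local Open Scope classical_set_scope.
Local Open Scope ring_scope.
Local Open Scope quotient_scope.

Section FreeModule.
Variables (k : comPzRingType) (T : choiceType).

Definition freeMod : Type := {fsfun T -> k with 0}.
HB.instance Definition _ := Choice.on freeMod.

Definition fcoef (f : freeMod) : T -> k := fun t => (f : {fsfun T -> k with 0}) t.
Definition supp (f : freeMod) : {fset T} := finsupp (f : {fsfun T -> k with 0}).

Lemma fcoefP (f g : freeMod) : fcoef f =1 fcoef g -> f = g.
Proof. by move=> h; apply/fsfunP => t; apply: h. Qed.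

Lemma fcoef_supp (f : freeMod) t : t \notin supp f -> fcoef f t = 0.
Proof. exact: fsfun_dflt. Qed.

Definition free_fun (S : {fset T}) (h : T -> k) : freeMod :=
  [fsfun t in S => h t].

Lemma fcoef_free_fun S h t :
  (t \notin S -> h t = 0) -> fcoef (free_fun S h) t = h t.
Proof.
move=> hS; rewrite /fcoef /free_fun fsfunE.
by case: ifPn => // /hS.
Qed.

Definition free_zero : freeMod := free_fun fset0 (fun=> 0).
Definition free_opp (f : freeMod) := free_fun (supp f) (fun t => - fcoef f t).
Definition free_add (f g : freeMod) :=
  free_fun (supp f `|` supp g)%fset (fun t => fcoef f t + fcoef g t).
Definition free_scale (c : k) (f : freeMod) :=
  free_fun (supp f) (fun t => c * fcoef f t).

Lemma fcoef_free_zero t : fcoef free_zero t = 0.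
Proof. exact: fcoef_free_fun. Qed.
Lemma fcoef_free_opp f t : fcoef (free_opp f) t = - fcoef f t.
Proof. by apply: fcoef_free_fun => /fcoef_supp ->; rewrite oppr0. Qed.
Lemma fcoef_free_add f g t : fcoef (free_add f g) t = fcoef f t + fcoef g t.
Proof.
apply: fcoef_free_fun; rewrite in_fsetU negb_or => /andP[/fcoef_supp -> /fcoef_supp ->].
by rewrite addr0.
Qed.
Lemma fcoef_free_scale c f t : fcoef (free_scale c f) t = c * fcoef f t.
Proof. by apply: fcoef_free_fun => /fcoef_supp ->; rewrite mulr0. Qed.

Fact free_addA : associative free_add.
Proof. by move=> f g h; apply: fcoefP => t; rewrite !fcoef_free_add addrA. Qed.
Fact free_addC : commutative free_add.
Proof. by move=> f g; apply: fcoefP => t; rewrite !fcoef_free_add addrC. Qed.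
Fact free_add0 : left_id free_zero free_add.
Proof. by move=> f; apply: fcoefP => t; rewrite fcoef_free_add fcoef_free_zero add0r. Qed.
Fact free_addN : left_inverse free_zero free_opp free_add.
Proof.
by move=> f; apply: fcoefP => t;
   rewrite fcoef_free_add fcoef_free_opp fcoef_free_zero addNr.
Qed.
HB.instance Definition _ :=
  GRing.isZmodule.Build freeMod free_addA free_addC free_add0 free_addN.

Fact free_scaleA c d f : free_scale c (free_scale d f) = free_scale (c * d) f.
Proof. by apply: fcoefP => t; rewrite !fcoef_free_scale mulrA. Qed.
Fact free_scale1 : left_id 1 free_scale.
Proof. by move=> f; apply: fcoefP => t; rewrite fcoef_free_scale mul1r. Qed.
Fact free_scaleDr : right_distributive free_scale +%R.
Proof.
by move=> c f g; apply: fcoefP => t;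
   rewrite !(fcoef_free_scale, fcoef_free_add) mulrDr.
Qed.
Fact free_scaleDl f : {morph free_scale^~ f : c d / c + d}.
Proof.
by move=> c d; apply: fcoefP => t;
   rewrite !(fcoef_free_scale, fcoef_free_add) mulrDl.
Qed.
HB.instance Definition _ := GRing.Zmodule_isLmodule.Build k freeMod
  free_scaleA free_scale1 free_scaleDr free_scaleDl.

Lemma fcoef0 t : fcoef 0 t = 0. Proof. exact: fcoef_free_zero. Qed.
Lemma fcoefD f g t : fcoef (f + g) t = fcoef f t + fcoef g t.
Proof. exact: fcoef_free_add. Qed.
Lemma fcoefZ c f t : fcoef (c *: f) t = c * fcoef f t.
Proof. exact: fcoef_free_scale. Qed.

Definition delta (t : T) : freeMod := free_fun [fset t]%fset (fun u => (u == t)%:R).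

Lemma fcoef_delta t u : fcoef (delta t) u = (u == t)%:R.
Proof. by apply: fcoef_free_fun; rewrite inE => /negbTE ->. Qed.

Definition flift (P : lmodType k) (phi : T -> P) (f : freeMod) : P :=
  \sum_(t <- supp f) fcoef f t *: phi t.

Section FLift.
Variables (P : lmodType k) (phi : T -> P).

Lemma fliftE f (S : {fset T}) : (supp f `<=` S)%fset ->
  flift phi f = \sum_(t <- S) fcoef f t *: phi t.
Proof.
move=> sub; apply: big_fset_incl => // t _ /fcoef_supp ->.
by rewrite scale0r.
Qed.

Lemma flift_linear : linear (flift phi).
Proof.
move=> c f g; set h := c *: f + g; set S := (supp h `|` (supp f `|` supp g))%fset.
rewrite !(@fliftE _ S); first last.
- by apply/fsubsetP => t; rewrite !in_fsetU => ->.
- by apply/fsubsetP => t; rewrite !in_fsetU => ->; rewrite orbT.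
- by apply/fsubsetP => t; rewrite !in_fsetU => ->; rewrite !orbT.
rewrite scaler_sumr -big_split /=; apply: eq_bigr => t _.
by rewrite /h fcoefD fcoefZ scalerDl scalerA.
Qed.
HB.instance Definition _ := GRing.isLinear.Build k freeMod P _ (flift phi) flift_linear.

Lemma flift_delta t : flift phi (delta t) = phi t.
Proof.
rewrite (@fliftE _ [fset t]%fset).
  by rewrite big_seq_fset1 fcoef_delta eqxx scale1r.
apply/fsubsetP => u; apply: contraLR; rewrite inE => ut.
by rewrite mem_finsupp -/(fcoef (delta t) u) fcoef_delta (negbTE ut) eqxx.
Qed.

End FLift.

Lemma free_decomp f : f = \sum_(t <- supp f) fcoef f t *: delta t.
Proof.
apply: fcoefP => u.
have -> (s : seq T) : fcoef (\sum_(t <- s) fcoef f t *: delta t) u =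
   \sum_(t <- s) fcoef f t * (u == t)%:R.
  by elim: s => [|t s IH]; rewrite ?big_nil ?fcoef0 // !big_cons fcoefD fcoefZ fcoef_delta IH.
have [uf|uf] := boolP (u \in supp f).
  rewrite (big_fsetD1 u) //= eqxx mulr1 big_seq_cond big1 ?addr0 // => t.
  by rewrite andbT !inE eq_sym => /andP[/negbTE -> _]; rewrite mulr0.
rewrite big_seq_cond big1 ?fcoef_supp // => t; rewrite andbT => tf.
by case: eqP => [E|]; [rewrite E tf in uf | rewrite mulr0].
Qed.

Lemma free_ind (Q : freeMod -> Prop) :
  Q 0 -> (forall c t f, Q f -> Q (c *: delta t + f)) -> forall f, Q f.
Proof.
move=> Q0 QD f; rewrite (free_decomp f).
by elim: (X in \sum_(t <- X) _) => [|t s IH]; rewrite ?big_nil // big_cons; apply: QD.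
Qed.

End FreeModule.

Lemma flift_eq (k : comPzRingType) (T : choiceType) (P : lmodType k) (phi psi : T -> P) : phi =1 psi ->
  flift phi =1 flift psi.
Proof. by move=> E f; apply: eq_bigr => t _; rewrite E. Qed.

Lemma flift_lin2 (k : comPzRingType) (T : choiceType) (P : lmodType k)
  (c : k) (phi psi : T -> P) f :
  flift (fun t => c *: phi t + psi t) f = c *: flift phi f + flift psi f.
Proof.
rewrite /flift scaler_sumr -big_split; apply: eq_bigr => t _ /=.
by rewrite scalerDr !scalerA mulrC.
Qed.

Section Submodules.
Variables (k : comPzRingType) (V : lmodType k).

Definition is_submod (S : set V) :=
  S 0 /\ forall c x y, S x -> S y -> S (c *: x + y).
Record submod := Submod { smod :> V -> Prop; smodP : is_submod smod }.

Lemma sm0 (P : submod) : P 0. Proof. by case: P => S []. Qed.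
Lemma smZD (P : submod) c x y : P x -> P y -> P (c *: x + y).
Proof. by case: P => S [] /= _; apply. Qed.
Lemma smD (P : submod) x y : P x -> P y -> P (x + y).
Proof. by move=> Px Py; rewrite -[x]scale1r; apply: smZD. Qed.
Lemma smZ (P : submod) c x : P x -> P (c *: x).
Proof. by move=> Px; rewrite -[_ *: _]addr0; apply: smZD => //; exact: sm0. Qed.
Lemma smN (P : submod) x : P x -> P (- x).
Proof. by rewrite -scaleN1r; apply: smZ. Qed.
Lemma smB (P : submod) x y : P x -> P y -> P (x - y).
Proof. by move=> Px Py; apply: smD => //; apply: smN. Qed.
Lemma smBC (P : submod) x y : P (x - y) -> P (y - x).
Proof. by move=> /smN; rewrite opprB. Qed.

Inductive in_lspan (A : set V) : V -> Prop :=
| in_lspan0 : in_lspan A 0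
| in_lspanZD c x y : A x -> in_lspan A y -> in_lspan A (c *: x + y).

Fact lspan_submod A : is_submod (in_lspan A).
Proof.
split=> [|c x y]; first exact: in_lspan0.
elim=> [|d u v Au _ IH] Ay; first by rewrite scaler0 add0r.
by rewrite scalerDr scalerA -addrA; apply: in_lspanZD => //; apply: IH.
Qed.
(** The submodule of linear combinations of elements of [A]. *)
Definition lspan A := Submod (lspan_submod A).

Lemma lspan_gen (A : set V) x : A x -> lspan A x.
Proof.
move=> Ax; rewrite -[x]scale1r -[_ *: _]addr0; apply: in_lspanZD => //.
exact: in_lspan0.
Qed.

Lemma lspan_min (A : set V) (P : submod) : A `<=` smod P -> smod (lspan A) `<=` smod P.
Proof.
by move=> AP x; elim=> [|c u v /AP Pu _]; [exact: sm0 | exact: smZD].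
Qed.

Fact full_submod_subproof : is_submod setT. Proof. by []. Qed.
Definition full_submod := Submod full_submod_subproof.

End Submodules.

Section SubModule.
Variables (k : comPzRingType) (V : lmodType k) (P : submod V).

Definition subm_pred : {pred V} := fun x => `[< P x >].
Lemma subm_closed : GRing.submod_closed subm_pred.
Proof.
split; first by apply/asboolP; exact: sm0.
by move=> c x y /asboolP Px /asboolP Py; apply/asboolP; exact: smZD.
Qed.
HB.instance Definition _ := GRing.isSubmodClosed.Build k V subm_pred subm_closed.

Record subm := Subm { subm_val : V; subm_in : subm_val \in subm_pred }.
HB.instance Definition _ := [isSub for subm_val].
HB.instance Definition _ := [Choice of subm by <:].
HB.instance Definition _ := [SubChoice_isSubLmodule of subm by <:].

Lemma submP (x : subm) : P (val x). Proof. exact/asboolP/(valP x). Qed.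
Definition insubm x (Px : P x) : subm := Subm (introT (asboolP (P x)) Px).

Lemma subm_valD (x y : subm) : subm_val (x + y) = subm_val x + subm_val y.
Proof. exact: (raddfD (val : subm -> V)). Qed.
Lemma subm_valB (x y : subm) : subm_val (x - y) = subm_val x - subm_val y.
Proof. exact: (raddfB (val : subm -> V)). Qed.
Lemma subm_valZ c (x : subm) : subm_val (c *: x) = c *: subm_val x.
Proof. exact: (linearZZ (val : subm -> V)). Qed.
Lemma subm_inj (x y : subm) : subm_val x = subm_val y -> x = y.
Proof. exact: val_inj. Qed.

End SubModule.

Section Quotient.
Variables (k : comPzRingType) (V : lmodType k) (P : submod V).

Definition quo_rel (x y : V) := `[< P (x - y) >].
Fact quo_rel_refl : reflexive quo_rel.
Proof. by move=> x; apply/asboolP; rewrite subrr; exact: sm0. Qed.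
Fact quo_rel_sym : symmetric quo_rel.
Proof. by move=> x y; apply/asboolP/asboolP; exact: smBC. Qed.
Fact quo_rel_trans : transitive quo_rel.
Proof.
move=> y x z /asboolP Pxy /asboolP Pyz; apply/asboolP.
by rewrite -(subrK y x) -addrA; exact: smD.
Qed.
Canonical quo_equiv := EquivRel quo_rel quo_rel_refl quo_rel_sym quo_rel_trans.

Definition quo : Type := {eq_quot quo_rel}.
HB.instance Definition _ := Choice.on quo.
HB.instance Definition _ := EqQuotient.on quo.

Definition cls (x : V) : quo := \pi_quo x.
Definition rep (q : quo) : V := repr q.

Lemma repK q : cls (rep q) = q. Proof. exact: reprK. Qed.
Lemma clsP x y : cls x = cls y <-> P (x - y).
Proof.
split; first by move=> /eqquotP/asboolP.
by move=> Pxy; apply/eqquotP/asboolP.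
Qed.
Lemma rep_cls x : P (rep (cls x) - x).
Proof. by apply/clsP; rewrite repK. Qed.

Definition quo_zero := cls 0.
Definition quo_opp q := cls (- rep q).
Definition quo_add q r := cls (rep q + rep r).
Definition quo_scale (c : k) q := cls (c *: rep q).

Lemma quo_oppE x : quo_opp (cls x) = cls (- x).
Proof. by apply/clsP; rewrite opprK addrC; apply/smBC/rep_cls. Qed.
Lemma quo_addE x y : quo_add (cls x) (cls y) = cls (x + y).
Proof. by apply/clsP; rewrite opprD addrACA; apply: smD; apply: rep_cls. Qed.
Lemma quo_scaleE c x : quo_scale c (cls x) = cls (c *: x).
Proof. by apply/clsP; rewrite -scalerBr; apply: smZ; apply: rep_cls. Qed.

Lemma quo_ind (Q : quo -> Prop) : (forall x, Q (cls x)) -> forall q, Q q.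
Proof. by move=> H q; rewrite -(repK q). Qed.

Fact quo_addA : associative quo_add.
Proof. by elim/quo_ind=> x; elim/quo_ind=> y; elim/quo_ind=> z; rewrite !quo_addE addrA. Qed.
Fact quo_addC : commutative quo_add.
Proof. by elim/quo_ind=> x; elim/quo_ind=> y; rewrite !quo_addE addrC. Qed.
Fact quo_add0 : left_id quo_zero quo_add.
Proof. by elim/quo_ind=> x; rewrite quo_addE add0r. Qed.
Fact quo_addN : left_inverse quo_zero quo_opp quo_add.
Proof. by elim/quo_ind=> x; rewrite quo_oppE quo_addE addNr. Qed.
HB.instance Definition _ :=
  GRing.isZmodule.Build quo quo_addA quo_addC quo_add0 quo_addN.

Fact quo_scaleA c d q : quo_scale c (quo_scale d q) = quo_scale (c * d) q.
Proof. by elim/quo_ind: q => x; rewrite !quo_scaleE scalerA. Qed.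
Fact quo_scale1 : left_id 1 quo_scale.
Proof. by elim/quo_ind=> x; rewrite quo_scaleE scale1r. Qed.
Fact quo_scaleDr : right_distributive quo_scale +%R.
Proof.
move=> c; elim/quo_ind=> x; elim/quo_ind=> y.
by rewrite -[_ + _]/(quo_add _ _) -[RHS]/(quo_add _ _) !(quo_addE, quo_scaleE) scalerDr.
Qed.
Fact quo_scaleDl q : {morph quo_scale^~ q : c d / c + d}.
Proof.
move=> c d; elim/quo_ind: q => x.
by rewrite -[RHS]/(quo_add _ _) !(quo_addE, quo_scaleE) scalerDl.
Qed.
HB.instance Definition _ := GRing.Zmodule_isLmodule.Build k quo
  quo_scaleA quo_scale1 quo_scaleDr quo_scaleDl.

Lemma cls_linear : linear cls.
Proof.
move=> c x y; rewrite -[RHS]/(quo_add _ _) -[c *: cls x]/(quo_scale c (cls x)).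
by rewrite quo_scaleE quo_addE.
Qed.
HB.instance Definition _ := GRing.isLinear.Build k V quo _ cls cls_linear.

Lemma cls0P x : cls x = 0 <-> P x.
Proof. by rewrite -[0](linear0 cls) clsP subr0. Qed.
Lemma rep0P q : q = 0 <-> P (rep q).
Proof. by rewrite -{1}(repK q) cls0P. Qed.

End Quotient.
Arguments cls {k V} P x.
Arguments rep {k V P} q.

Section FilteredModules.
Variable k : comPzRingType.

(** Filtrations are decreasing and start with [F^0 A = A]. *)
Record filtMod := FiltMod {
  fm_mod :> lmodType k;
  fil : nat -> submod fm_mod;
  fil0 : forall x, fil 0 x;
  filS : forall m x, fil m.+1 x -> fil m x }.

Lemma fil_le (A : filtMod) m n (x : A) : (m <= n)%N -> fil A n x -> fil A m x.
Proof.
by move=> /subnK <-; elim: (n - m)%N => //= d IH; rewrite addSn => /filS.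
Qed.

Definition separated (A : filtMod) :=
  forall x : A, (forall m, fil A m x) -> x = 0.

(** With [separated]: [A -> lim A / F^m A] is bijective. *)
Definition complete (A : filtMod) :=
  forall u : nat -> A, (forall m, fil A m (u m.+1 - u m)) ->
  exists x, forall m, fil A m (x - u m).

Record topMod := TopMod {
  tm_fm :> filtMod;
  tm_separated : separated tm_fm;
  tm_complete : complete tm_fm }.

(** Morphisms satisfy [f (F^m A) `<=` F^m B], so they are in particular
    continuous. *)
Record filtHom (A B : filtMod) := FiltHom {
  hom_fun :> A -> B;
  hom_linear : linear hom_fun;
  hom_fil : forall m x, fil A m x -> fil B m (hom_fun x) }.

HB.instance Definition _ (A B : filtMod) (f : filtHom A B) :=
  GRing.isLinear.Build k A B _ (hom_fun f) (hom_linear f).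

Definition lin_deg s (A B : filtMod) (f : A -> B) :=
  linear f /\ forall m x, fil A m x -> fil B (m + s) (f x).

Definition bilin_deg s (A B C : filtMod) (b : A -> B -> C) :=
  [/\ forall y, linear (b^~ y), forall x, linear (b x) &
      forall i j x y, fil A i x -> fil B j y -> fil C (i + j + s) (b x y)].

(** Filtered bilinear maps: [F^i A x F^j B -> F^(i + j) C]. *)
Record fbil (A B C : filtMod) := Fbil {
  fb_fun :> A -> B -> C;
  fbP : bilin_deg 0 fb_fun }.

Definition hom_id (A : filtMod) : filtHom A A :=
  @FiltHom A A id (fun c x y => erefl) (fun m x Fx => Fx).

Lemma fb_fil (A B C : filtMod) (b : fbil A B C) i j x y :
  fil A i x -> fil B j y -> fil C (i + j) (b x y).
Proof. by move=> Fx Fy; rewrite -[(i + j)%N]addn0; case: (fbP b) => _ _; apply. Qed.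

Lemma fb_linl (A B C : filtMod) (b : fbil A B C) c x x' y :
  b (c *: x + x') y = c *: b x y + b x' y.
Proof. by case: (fbP b) => + _ _; apply. Qed.
Lemma fb_linr (A B C : filtMod) (b : fbil A B C) c x y y' :
  b x (c *: y + y') = c *: b x y + b x y'.
Proof. by case: (fbP b) => _ + _; apply. Qed.

Lemma lin_raw (A B : lmodType k) (f : A -> B) : linear f ->
  (f 0 = 0) * (forall x y, f (x + y) = f x + f y) *
  (forall x y, f (x - y) = f x - f y) * (forall c x, f (c *: x) = c *: f x).
Proof.
move=> lf; have f0 : f 0 = 0.
  by have := lf (-1) 0 0; rewrite scaler0 addr0 scaleN1r addNr.
have fZ c x : f (c *: x) = c *: f x by have := lf c x 0; rewrite f0 !addr0.
have fD x y : f (x + y) = f x + f y by have := lf 1 x y; rewrite !scale1r.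
by do !split=> //; move=> x y; rewrite fD -scaleN1r fZ scaleN1r.
Qed.

Section Completion.
Variable A : filtMod.

Record invlim := Invlim {
  invlim_seq : forall m, quo (fil A m);
  invlim_compat : forall m, cls (fil A m) (rep (invlim_seq m.+1)) = invlim_seq m }.

HB.instance Definition _ := gen_eqMixin invlim.
HB.instance Definition _ := gen_choiceMixin invlim.

Lemma invlimP (x y : invlim) : (forall m, invlim_seq x m = invlim_seq y m) -> x = y.
Proof.
case: x y => [x xP] [y yP] /= E; have {E} E : x = y.
  exact: functional_extensionality_dep.
by case: _ / E yP => yP; congr Invlim; exact: Prop_irrelevance.
Qed.

Definition coherent (u : nat -> A) := forall m, fil A m (u m.+1 - u m).
Fact invlim_of_subproof u (uP : coherent u) m :
  cls (fil A m) (rep (cls (fil A m.+1) (u m.+1))) = cls (fil A m) (u m).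
Proof.
apply/clsP; rewrite -(subrK (u m.+1) (rep _)) -addrA; apply: smD => //.
by apply: filS; exact: rep_cls.
Qed.
Definition invlim_of u (uP : coherent u) : invlim := Invlim (invlim_of_subproof uP).

Definition lrep (x : invlim) m : A := rep (invlim_seq x m).
Lemma lrep_coherent x : coherent (lrep x).
Proof. by move=> m; apply/clsP; rewrite invlim_compat repK. Qed.
Lemma lrep_of u (uP : coherent u) m : fil A m (lrep (invlim_of uP) m - u m).
Proof. exact: rep_cls. Qed.
Lemma invlim_of_eq u v (uP : coherent u) (vP : coherent v) :
  (forall m, fil A m (u m - v m)) -> invlim_of uP = invlim_of vP.
Proof. by move=> uv; apply: invlimP => m /=; apply/clsP. Qed.
Lemma lrepK x (uP : coherent (lrep x)) : invlim_of uP = x.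
Proof. by apply: invlimP => m; exact: repK. Qed.

Fact coherent0 : coherent (fun=> 0).
Proof. by move=> m; rewrite subrr; exact: sm0. Qed.
Fact coherentZD c u v : coherent u -> coherent v ->
  coherent (fun m => c *: u m + v m).
Proof.
by move=> uP vP m; rewrite opprD addrACA -scalerBr; apply: smZD.
Qed.
Fact coherentD u v : coherent u -> coherent v -> coherent (fun m => u m + v m).
Proof. by move=> uP vP m; rewrite opprD addrACA; apply: smD. Qed.
Fact coherentZ c u : coherent u -> coherent (fun m => c *: u m).
Proof. by move=> uP m; rewrite -scalerBr; apply: smZ. Qed.
Fact coherentN u : coherent u -> coherent (fun m => - u m).
Proof. by move=> uP m; rewrite -opprD; apply: smN. Qed.

Definition invlim_zero := invlim_of coherent0.
Definition invlim_add x y := invlim_of (coherentD (lrep_coherent x) (lrep_coherent y)).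
Definition invlim_opp x := invlim_of (coherentN (lrep_coherent x)).
Definition invlim_scale c x := invlim_of (coherentZ c (lrep_coherent x)).

Lemma invlim_zeroE m : invlim_seq invlim_zero m = 0. Proof. exact: linear0. Qed.
Lemma invlim_addE x y m : invlim_seq (invlim_add x y) m = invlim_seq x m + invlim_seq y m.
Proof. by rewrite /= linearD /= !repK. Qed.
Lemma invlim_oppE x m : invlim_seq (invlim_opp x) m = - invlim_seq x m.
Proof. by rewrite /= linearN /= repK. Qed.
Lemma invlim_scaleE c x m : invlim_seq (invlim_scale c x) m = c *: invlim_seq x m.
Proof. by rewrite /= linearZZ /= repK. Qed.

Fact invlim_addA : associative invlim_add.
Proof. by move=> x y z; apply: invlimP => m; rewrite !invlim_addE addrA. Qed.
Fact invlim_addC : commutative invlim_add.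
Proof. by move=> x y; apply: invlimP => m; rewrite !invlim_addE addrC. Qed.
Fact invlim_add0 : left_id invlim_zero invlim_add.
Proof. by move=> x; apply: invlimP => m; rewrite invlim_addE invlim_zeroE add0r. Qed.
Fact invlim_addN : left_inverse invlim_zero invlim_opp invlim_add.
Proof.
by move=> x; apply: invlimP => m; rewrite invlim_addE invlim_oppE invlim_zeroE addNr.
Qed.
HB.instance Definition _ :=
  GRing.isZmodule.Build invlim invlim_addA invlim_addC invlim_add0 invlim_addN.

Fact invlim_scaleA c d x : invlim_scale c (invlim_scale d x) = invlim_scale (c * d) x.
Proof. by apply: invlimP => m; rewrite !invlim_scaleE scalerA. Qed.
Fact invlim_scale1 : left_id 1 invlim_scale.
Proof. by move=> x; apply: invlimP => m; rewrite invlim_scaleE scale1r. Qed.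
Fact invlim_scaleDr : right_distributive invlim_scale +%R.
Proof.
move=> c x y; apply: invlimP => m.
by rewrite -[x + y]/(invlim_add x y) -[RHS]/(invlim_seq (invlim_add _ _) m)
  !(invlim_addE, invlim_scaleE) scalerDr.
Qed.
Fact invlim_scaleDl x : {morph invlim_scale^~ x : c d / c + d}.
Proof.
move=> c d; apply: invlimP => m.
by rewrite -[RHS]/(invlim_seq (invlim_add _ _) m) !(invlim_addE, invlim_scaleE) scalerDl.
Qed.
HB.instance Definition _ := GRing.Zmodule_isLmodule.Build k invlim
  invlim_scaleA invlim_scale1 invlim_scaleDr invlim_scaleDl.

Definition invlim_proj m (x : invlim) : quo (fil A m) := invlim_seq x m.
Lemma invlim_proj_linear m : linear (invlim_proj m).
Proof.
move=> c x y; rewrite /invlim_proj -[_ + y]/(invlim_add (invlim_scale c x) y).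
by rewrite invlim_addE invlim_scaleE.
Qed.
Arguments invlim_proj : simpl never.
HB.instance Definition _ m :=
  GRing.isLinear.Build k invlim (quo (fil A m)) _ (invlim_proj m) (invlim_proj_linear m).

Fact invlim_fil_subproof m : is_submod (fun x => invlim_proj m x = 0).
Proof.
split=> [|c x y x0 y0]; first exact: linear0.
by rewrite linearP /= x0 y0 scaler0 addr0.
Qed.
Definition invlim_fil m := Submod (invlim_fil_subproof m).

Lemma invlim_filP m x : invlim_fil m x <-> fil A m (lrep x m).
Proof. exact: rep0P. Qed.

Fact invlim_fil0 x : invlim_fil 0 x.
Proof. by apply/invlim_filP; exact: fil0. Qed.
Fact invlim_filS m x : invlim_fil m.+1 x -> invlim_fil m x.
Proof.
move=> /invlim_filP/filS Fx; apply/invlim_filP; rewrite -[lrep x m](subKr (lrep x m.+1)).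
exact/smB/lrep_coherent.
Qed.
Definition invlim_filt : filtMod := @FiltMod invlim invlim_fil invlim_fil0 invlim_filS.

Fact invlim_separated : separated invlim_filt.
Proof. by move=> x x0; apply: invlimP => m; rewrite invlim_zeroE; exact: x0. Qed.

Lemma invlim_fil_sub m (x y : invlim) :
  invlim_fil m (x - y) <-> fil A m (lrep x m - lrep y m).
Proof.
have E : invlim_proj m (x - y) = invlim_seq x m - invlim_seq y m := linearB (invlim_proj m) x y.
rewrite -clsP !repK; split=> h; first by apply/subr0_eq; rewrite -E.
by rewrite -[invlim_fil _ _]/(invlim_proj m (x - y) = 0) E h subrr.
Qed.

Fact invlim_complete : complete invlim_filt.
Proof.
move=> u uP; pose v m := lrep (u m) m.
have vP : coherent v.
  move=> m; have /invlim_fil_sub := uP m => uPm.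
  rewrite /v -(subrK (lrep (u m.+1) m) (lrep _ m.+1)) -addrA.
  by apply: smD => //; exact: lrep_coherent.
exists (invlim_of vP) => m; apply/invlim_fil_sub; exact: lrep_of.
Qed.

Definition hat : topMod := TopMod invlim_separated invlim_complete.

Fact coherent_cst (a : A) : coherent (fun=> a).
Proof. by move=> m; rewrite subrr; exact: sm0. Qed.
Definition to_hat (a : A) : hat := invlim_of (coherent_cst a).

Lemma to_hat_linear : linear to_hat.
Proof.
move=> c x y; apply: invlimP => m; rewrite -!/(invlim_proj m _) linearP.
by rewrite /invlim_proj /= linearP.
Qed.
Lemma to_hat_fil m a : fil A m a -> fil hat m (to_hat a).
Proof. by move=> Fa; apply/cls0P. Qed.

End Completion.

(** [hlift f x] is the limit of [f] along representatives of [x]; it is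
    meaningful when [f] satisfies [lin_deg]. *)
Section Extension.
Variables (A : filtMod) (P : topMod).

Definition hlift (f : A -> P) (x : hat A) : P :=
  xget 0 [set p | forall m, fil P m (p - f (lrep x m))].

Lemma hliftP s f x : lin_deg s f -> forall m, fil P m (hlift f x - f (lrep x m)).
Proof.
case=> lf df; rewrite /hlift; case: xgetP => //= nex.
have [|p pP] := @tm_complete P (fun m => f (lrep x m)).
  move=> m; rewrite -(lin_raw lf); apply: (@fil_le _ _ (m + s)).
    by rewrite leq_addr.
  by apply: df; exact: lrep_coherent.
by case: (nex p).
Qed.

Lemma hlift_uniq s f x p : lin_deg s f ->
  (forall m, exists2 a, fil A m (a - lrep x m) & fil P m (p - f a)) ->
  p = hlift f x.
Proof.
move=> fP H; apply/subr0_eq/tm_separated => m.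
have [a Fa Fp] := H m; have [lf df] := fP.
rewrite -(subrK (f a) p) -addrA; apply: smD => //; apply: smBC.
rewrite -(subrK (f (lrep x m)) (hlift _ _)) -addrA; apply: smD.
  exact: hliftP fP m.
rewrite -(lin_raw lf); apply: (@fil_le _ _ (m + s)); first by rewrite leq_addr.
by apply: df; apply: smBC.
Qed.

Lemma hlift_to s f a : lin_deg s f -> hlift f (to_hat a) = f a.
Proof.
move=> fP; apply/esym/(hlift_uniq fP) => m; exists a; last first.
  by rewrite subrr; exact: sm0.
exact/smBC/lrep_of.
Qed.

Lemma hlift_linear s f : lin_deg s f -> linear (hlift f).
Proof.
move=> fP c x y; apply/esym/(hlift_uniq fP) => m.
exists (c *: lrep x m + lrep y m).
  by apply/clsP; rewrite linearP /= !repK -!/(invlim_proj m _) linearP.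
case: (fP) => -> _; rewrite opprD addrACA -scalerBr.
by apply: smZD; exact: hliftP fP m.
Qed.

Lemma lrep_le (x : hat A) i n : (i <= n)%N -> fil A i (lrep x n - lrep x i).
Proof.
move=> /subnK <-; elim: (n - i)%N => /= [|d IH]; first by rewrite subrr; exact: sm0.
rewrite addSn -(subrK (lrep x (d + i)) (lrep x _)) -addrA; apply: smD => //.
by apply: (@fil_le _ _ (d + i)); [exact: leq_addl | exact: lrep_coherent].
Qed.

Lemma hlift_deg s f : lin_deg s f -> lin_deg s (hlift f).
Proof.
move=> fP; split; first exact: hlift_linear fP.
move=> i x /invlim_filP Fx; rewrite -(subrK (f (lrep x (i + s))) (hlift f x)).
apply: smD; first exact: hliftP fP _.
case: (fP) => _; apply; rewrite -(subrK (lrep x i) (lrep x _)).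
by apply: smD => //; apply: lrep_le; rewrite leq_addr.
Qed.

Lemma hlift_lin2 s t c (f g : A -> P) x : lin_deg s f -> lin_deg t g ->
  hlift (fun a => c *: f a + g a) x = c *: hlift f x + hlift g x.
Proof.
move=> fP gP; apply/esym; apply: (@hlift_uniq 0).
  split=> [d a b | m a Fa].
    case: fP gP => -> _ [-> _]; rewrite !scalerDr !scalerA.
    by rewrite addrACA (mulrC c d).
  rewrite addn0; case: fP gP => _ fF [_ gF]; apply: smZD.
    by apply: (@fil_le _ _ (m + s)); [rewrite leq_addr | exact: fF].
  by apply: (@fil_le _ _ (m + t)); [rewrite leq_addr | exact: gF].
move=> m; exists (lrep x m); first by rewrite subrr; exact: sm0.
by rewrite opprD addrACA -scalerBr; apply: smZD; [exact: hliftP fP m | exact: hliftP gP m].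
Qed.

End Extension.

Section HatBil.
Variables (A B C : filtMod) (b : fbil A B C).

Lemma fb_sub m (x x' : A) (y y' : B) :
  fil A m (x - x') -> fil B m (y - y') -> fil C m (b x y - b x' y').
Proof.
move=> Fx Fy; have [bl br _] := fbP b.
rewrite -(subrK (b x' y) (b x y)) -addrA -(lin_raw (bl y)) -(lin_raw (br x')).
apply: smD.
  by rewrite -[m]addn0; apply: fb_fil => //; exact: fil0.
by rewrite -[m]add0n; apply: fb_fil => //; exact: fil0.
Qed.

Fact hat_bil_coherent (x : hat A) (y : hat B) :
  coherent (fun m => b (lrep x m) (lrep y m)).
Proof. by move=> m; apply: fb_sub; exact: lrep_coherent. Qed.
Definition hat_bil_fun (x : hat A) (y : hat B) : hat C :=
  invlim_of (hat_bil_coherent x y).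

Lemma lrepZD (D : filtMod) c (x y : hat D) m :
  fil D m (lrep (c *: x + y) m - (c *: lrep x m + lrep y m)).
Proof. by apply/clsP; rewrite linearP /= !repK -!/(invlim_proj m _) linearP. Qed.

Fact hat_bilP : bilin_deg 0 hat_bil_fun.
Proof.
split=> [y c x x'|x c y y'|i j x y /invlim_filP Fx /invlim_filP Fy].
- apply: invlimP => m; rewrite -[RHS]/(invlim_proj m _) linearP /invlim_proj /= -linearP.
  apply/clsP; rewrite -fb_linl; apply: fb_sub; first exact: lrepZD.
  by rewrite subrr; exact: sm0.
- apply: invlimP => m; rewrite -[RHS]/(invlim_proj m _) linearP /invlim_proj /= -linearP.
  apply/clsP; rewrite -fb_linr; apply: fb_sub; last exact: lrepZD.
  by rewrite subrr; exact: sm0.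
apply/cls0P; rewrite addn0; apply: fb_fil.
  rewrite -(subrK (lrep x i) (lrep x _)); apply: smD => //.
  by apply: lrep_le; rewrite leq_addr.
rewrite -(subrK (lrep y j) (lrep y _)); apply: smD => //.
by apply: lrep_le; rewrite leq_addl.
Qed.
Definition hat_bil : fbil (hat A) (hat B) (hat C) := Fbil hat_bilP.

Lemma hat_bil_to x y : hat_bil (to_hat x) (to_hat y) = to_hat (b x y).
Proof. by apply: invlimP => m; apply/clsP; apply: fb_sub; exact: lrep_of. Qed.

End HatBil.

Section Tensor.
Variables M N : filtMod.

Inductive tens_rel : freeMod k (M * N)%type -> Prop :=
| tens_rel_l c x x' y : tens_rel
    (delta k (c *: x + x', y) - (c *: delta k (x, y) + delta k (x', y)))
| tens_rel_r c x y y' : tens_rel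
    (delta k (x, c *: y + y') - (c *: delta k (x, y) + delta k (x, y'))).

Definition tens_mod := quo (lspan tens_rel).
Definition tpure (x : M) (y : N) : tens_mod := cls _ (delta k (x, y)).

Lemma tpure_linl c x x' y : tpure (c *: x + x') y = c *: tpure x y + tpure x' y.
Proof. by rewrite /tpure -linearP; apply/clsP; apply: lspan_gen; left. Qed.
Lemma tpure_linr c x y y' : tpure x (c *: y + y') = c *: tpure x y + tpure x y'.
Proof. by rewrite /tpure -linearP; apply/clsP; apply: lspan_gen; right. Qed.

(** [F^m (M (x) N)] is the sum of the images of the [F^i M (x) F^j N] over
    [i + j >= m], that is, over [i + j = m]. *)
Inductive tens_gen m : tens_mod -> Prop :=
  TensGen i j x y of (m <= i + j)%N & fil M i x & fil N j y :
    tens_gen m (tpure x y).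
Definition tens_fil m : submod tens_mod := lspan (tens_gen m).

Lemma tens_ind (Q : tens_mod -> Prop) :
  Q 0 -> (forall c x y t, Q t -> Q (c *: tpure x y + t)) -> forall t, Q t.
Proof.
move=> Q0 QD; elim/quo_ind; elim/free_ind => [|c [x y] f Qf].
  by rewrite linear0.
by rewrite linearP; exact: QD.
Qed.

Fact tens_fil0 t : tens_fil 0 t.
Proof.
elim/tens_ind: t => [|c x y t Ft]; first exact: sm0.
apply: smZD => //; apply: lspan_gen; apply: (@TensGen _ 0 0) => //; exact: fil0.
Qed.
Fact tens_filS m t : tens_fil m.+1 t -> tens_fil m t.
Proof.
apply: lspan_min => _ [i j x y mij Fx Fy]; apply: lspan_gen.
by apply: TensGen Fx Fy; exact: ltnW.
Qed.
Definition tens : filtMod := FiltMod tens_fil0 tens_filS.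

Section Lift.
Variable P : filtMod.

Definition tlift (b : M -> N -> P) (t : tens) : P :=
  flift (fun xy => b xy.1 xy.2) (rep t).

Section LiftTheory.
Variables (s : nat) (b : M -> N -> P).
Hypothesis bP : bilin_deg s b.

Let bb := fun xy : M * N => b xy.1 xy.2.

Lemma tlift_cls f : tlift b (cls _ f) = flift bb f.
Proof.
apply/subr0_eq; rewrite /tlift -linearB /=.
move: (rep_cls (lspan tens_rel) f); elim=> [|c u v uP _ IH]; first exact: linear0.
rewrite linearP /= IH addr0.
suff -> : flift bb u = 0 by rewrite scaler0.
case: bP uP => bl br _ [d x x' y|d x y y']; rewrite linearB linearP /= !flift_delta /bb /=.
  by rewrite (bl y) subrr.
by rewrite (br x) subrr.
Qed.
Lemma tlift_pure x y : tlift b (tpure x y) = b x y.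
Proof. by rewrite tlift_cls flift_delta. Qed.
Lemma tlift_linear : linear (tlift b).
Proof.
move=> c; elim/quo_ind=> f; elim/quo_ind=> g.
by rewrite -linearP !tlift_cls linearP.
Qed.
Lemma tlift_deg : lin_deg s (tlift b).
Proof.
split=> [|m t]; first exact: tlift_linear.
elim=> [|c _ u [i j x y mij Fx Fy] _ IH].
  by rewrite (lin_raw tlift_linear); exact: sm0.
rewrite tlift_linear tlift_pure; apply: smZD => //.
apply: (@fil_le _ _ (i + j + s)); first by rewrite leq_add2r.
by case: bP => _ _; apply.
Qed.
End LiftTheory.

Lemma tlift_lin2 c (b b' : M -> N -> P) t :
  tlift (fun x y => c *: b x y + b' x y) t = c *: tlift b t + tlift b' t.
Proof. exact: flift_lin2. Qed.
End Lift.

End Tensor.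

Definition ctens (M N : filtMod) : topMod := hat (tens M N).

Definition ct (M N : filtMod) (x : M) (y : N) : ctens M N :=
  to_hat (tpure x y : tens M N).

Fact ct_deg (M N : filtMod) : bilin_deg 0 (@ct M N).
Proof.
split=> [y c x x'|x c y y'|i j x y Fx Fy].
- by rewrite /ct tpure_linl to_hat_linear.
- by rewrite /ct tpure_linr to_hat_linear.
apply: to_hat_fil; apply: lspan_gen; apply: TensGen Fx Fy.
by rewrite addn0.
Qed.

Section CTLift.
Variables (M N : filtMod) (P : topMod).

Definition ctlift (b : M -> N -> P) : ctens M N -> P := hlift (tlift b).

Lemma ctlift_pure s b x y : bilin_deg s b -> ctlift b (ct x y) = b x y.
Proof. by move=> bP; rewrite /ctlift (hlift_to _ (tlift_deg bP)) (tlift_pure bP). Qed.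

Lemma ctlift_deg s b : bilin_deg s b -> lin_deg s (ctlift b).
Proof. by move=> bP; apply/hlift_deg/tlift_deg. Qed.

Lemma ctlift_lin2 s s' c (b b' : M -> N -> P) t :
  bilin_deg s b -> bilin_deg s' b' ->
  ctlift (fun x y => c *: b x y + b' x y) t = c *: ctlift b t + ctlift b' t.
Proof.
move=> bP bP'; rewrite -(hlift_lin2 _ _ (tlift_deg bP) (tlift_deg bP')).
by congr hlift; apply/funext => u; exact: tlift_lin2.
Qed.

Fact ctlift_hom_fil (b : fbil M N P) m t :
  fil (ctens M N) m t -> fil P m (ctlift b t).
Proof. by case: (ctlift_deg (fbP b)) => _ H /H; rewrite addn0. Qed.
Definition ctlift_hom (b : fbil M N P) : filtHom (ctens M N) P :=
  FiltHom (proj1 (ctlift_deg (fbP b))) (@ctlift_hom_fil b).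

End CTLift.


Fact ct_map_fbilP (A A' B B' : filtMod) (f : filtHom A A') (g : filtHom B B') :
  bilin_deg 0 (fun x y => ct (f x) (g y)).
Proof.
have [cl cr cF] := @ct_deg A' B'.
split=> [y c x x'|x c y y'|i j x y Fx Fy].
- by rewrite hom_linear (cl (g y)).
- by rewrite hom_linear (cr (f x)).
by apply: cF; exact: hom_fil.
Qed.
Definition ct_map (A A' B B' : filtMod) (f : filtHom A A') (g : filtHom B B') :
  filtHom (ctens A B) (ctens A' B') := ctlift_hom (Fbil (ct_map_fbilP f g)).

Fact ct_swapP (A B : filtMod) : bilin_deg 0 (fun (x : A) (y : B) => ct y x).
Proof.
have [cl cr cF] := @ct_deg B A.
split=> [y|x|i j x y Fx Fy]; [exact: cr | exact: cl |].
by rewrite (addnC i); exact: cF.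
Qed.
Definition ct_swap (A B : filtMod) : filtHom (ctens A B) (ctens B A) :=
  ctlift_hom (Fbil (@ct_swapP A B)).

Fact ct_assoc_innerP (A B C : filtMod) n (z : C) : fil C n z ->
  bilin_deg n (fun (x : A) (y : B) => ct x (ct y z)).
Proof.
move=> Fz; have [cl cr cF] := @ct_deg A (ctens B C).
have [cl' cr' cF'] := @ct_deg B C.
split=> [y|x c y y'|i j x y Fx Fy]; first exact: cl.
  by rewrite (cl' z) (cr x).
rewrite -addnA -[(i + _)%N]addn0; apply: cF => //.
by rewrite -[(j + n)%N]addn0; exact: cF'.
Qed.
Fact ct_assocP (A B C : filtMod) : bilin_deg 0
  (fun (t : ctens A B) (z : C) => ctlift (fun x y => ct x (ct y z)) t).
Proof.
have inP z := @ct_assoc_innerP A B C 0 z (fil0 z).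
split=> [z|t c z z'|i j t z Ft Fz].
- by case: (ctlift_deg (inP z)).
- apply: etrans (ctlift_lin2 c t (inP z) (inP z')); congr (ctlift _ t).
  apply/funext => x; apply/funext => y.
  have [_ cr _] := @ct_deg A (ctens B C); have [_ cr' _] := @ct_deg B C.
  by rewrite (cr' y) (cr x).
rewrite addn0.
by case: (ctlift_deg (@ct_assoc_innerP A B C j z Fz)) => _; apply.
Qed.
(** [(x (x) y) (x) z |-> x (x) (y (x) z)] *)
Definition ct_assoc (A B C : filtMod) :
  filtHom (ctens (ctens A B) C) (ctens A (ctens B C)) :=
  ctlift_hom (Fbil (@ct_assocP A B C)).

Lemma ct_assocE (A B C : filtMod) (x : A) (y : B) (z : C) :
  ct_assoc A B C (ct (ct x y) z) = ct x (ct y z).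
Proof.
apply: etrans (ctlift_pure (ct x y) z (@ct_assocP A B C)) _.
exact: (ctlift_pure x y (@ct_assoc_innerP A B C 0 z (fil0 z))).
Qed.

(** The bilinear map [(a (x) a', b (x) b') |-> f a b (x) g a' b']. *)
Section CTBil.
Variables (A B C A' B' C' : filtMod) (f : fbil A B C) (g : fbil A' B' C').

Definition ct_bil_fun (t : ctens A A') (u : ctens B B') : ctens C C' :=
  ctlift (fun a a' => ctlift (fun b b' => ct (f a b) (g a' b')) u) t.

Let ctL := @ct_deg C C'.

Lemma ct_bil_inP i i' a a' : fil A i a -> fil A' i' a' ->
  bilin_deg (i + i') (fun b b' => ct (f a b) (g a' b')).
Proof.
move=> Fa Fa'; have [cl cr cF] := ctL.
split=> [b' c b1 b2|b c b1 b2|j j' b b' Fb Fb'].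
- by rewrite fb_linr (cl (g a' b')).
- by rewrite fb_linr (cr (f a b)).
by rewrite addnC addnACA -[X in fil _ X]addn0; apply: cF; exact: fb_fil.
Qed.

Lemma ct_bil_midP j u : fil (ctens B B') j u ->
  bilin_deg j (fun a a' => ctlift (fun b b' => ct (f a b) (g a' b')) u).
Proof.
have [cl cr cF] := ctL => Fu.
have inP a a' := ct_bil_inP (fil0 a) (fil0 a').
split=> [a' c a1 a2|a c a1 a2|i i' a a' Fa Fa'].
- apply: etrans (ctlift_lin2 c u (inP a1 a') (inP a2 a')); congr (ctlift _ u).
  by apply/funext => b; apply/funext => b'; rewrite fb_linl (cl (g a' b')).
- apply: etrans (ctlift_lin2 c u (inP a a1) (inP a a2)); congr (ctlift _ u).
  by apply/funext => b; apply/funext => b'; rewrite fb_linl (cr (f a b)).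
by rewrite addnC; case: (ctlift_deg (ct_bil_inP Fa Fa')) => _; apply.
Qed.

Fact ct_bilP : bilin_deg 0 ct_bil_fun.
Proof.
have inP a a' := ct_bil_inP (fil0 a) (fil0 a').
have midP u := ct_bil_midP (fil0 u).
split=> [u|t c u v|i j t u Ft Fu].
- by case: (ctlift_deg (midP u)).
- apply: etrans (ctlift_lin2 c t (midP u) (midP v)); congr (ctlift _ t).
  apply/funext => a; apply/funext => a'.
  by case: (ctlift_deg (inP a a')) => + _; apply.
by rewrite addn0; case: (ctlift_deg (ct_bil_midP Fu)) => _; apply.
Qed.
Definition ct_bil : fbil (ctens A A') (ctens B B') (ctens C C') := Fbil ct_bilP.

Lemma ct_bilE a a' b b' :
  ct_bil (ct a a') (ct b b') = ct (f a b) (g a' b').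
Proof.
apply: etrans (ctlift_pure a a' (ct_bil_midP (fil0 (ct b b')))) _.
exact: (ctlift_pure b b' (ct_bil_inP (fil0 a) (fil0 a'))).
Qed.

End CTBil.

(** The unit object: [k] with [F^0 k = k] and [F^m k = 0] for [m > 0]. *)
Section UnitObject.

Fact unit_fil_subproof m : is_submod (fun x : k^o => (0 < m)%N -> x = 0).
Proof.
split=> // c x y x0 y0 m0; rewrite x0 // y0 // addr0.
exact: scaler0.
Qed.
Definition unit_fil m := Submod (unit_fil_subproof m).
Fact unit_fil0 (x : k^o) : unit_fil 0 x. Proof. by []. Qed.
Fact unit_filS m (x : k^o) : unit_fil m.+1 x -> unit_fil m x.
Proof. by move=> x0 m0; apply: x0. Qed.
Definition unit_filt : filtMod := FiltMod unit_fil0 unit_filS.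
Fact unit_separated : separated unit_filt.
Proof. by move=> x /(_ 1%N); apply. Qed.
Fact unit_complete : complete unit_filt.
Proof.
move=> u uP; exists (u 1%N) => -[|m] // _; elim: m => [|m IH]; first exact: subrr.
rewrite -(subrK (u m.+1) (u 1%N)) -addrA IH add0r.
by rewrite -opprB (uP m.+1) // oppr0.
Qed.
Definition unit_obj : topMod := TopMod unit_separated unit_complete.

Variable A : filtMod.
Fact unit_lP : bilin_deg 0 (fun (c : unit_obj) (x : A) => (c : k) *: x).
Proof.
split=> [x d c c'|c d x y|i j c x Fc Fx].
- by rewrite scalerDl -scalerA.
- by rewrite scalerDr !scalerA mulrC.
rewrite addn0; case: i Fc => [|i] Fc; first exact: smZ.
by rewrite (Fc _) // scale0r; exact: sm0.
Qed.
Fact unit_rP : bilin_deg 0 (fun (x : A) (c : unit_obj) => (c : k) *: x).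
Proof.
have [l r F] := unit_lP; split=> // i j x c Fx Fc.
by rewrite (addnC i); exact: F.
Qed.
End UnitObject.

Definition ct_unitl (A : topMod) : filtHom (ctens unit_obj A) A :=
  ctlift_hom (Fbil (unit_lP A)).
Definition ct_unitr (A : topMod) : filtHom (ctens A unit_obj) A :=
  ctlift_hom (Fbil (unit_rP A)).

Record is_alg (A : filtMod) (mul : fbil A A A) (one : A) : Prop := IsAlg {
  alg_mulA : forall a b c, mul a (mul b c) = mul (mul a b) c;
  alg_mul1l : forall a, mul one a = a;
  alg_mul1r : forall a, mul a one = a }.

Record topAlg := TopAlg {
  ta_mod :> topMod;
  ta_mul : fbil ta_mod ta_mod ta_mod;
  ta_one : ta_mod;
  ta_alg : is_alg ta_mul ta_one }.

Record is_coalg (C : topMod) (Delta : filtHom C (ctens C C)) (eps : filtHom C unit_obj) :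
  Prop := IsCoalg {
  coalg_assoc : forall x, ct_assoc C C C (ct_map Delta (hom_id C) (Delta x)) =
                          ct_map (hom_id C) Delta (Delta x);
  coalg_comm : forall x, ct_swap C C (Delta x) = Delta x;
  coalg_unitl : forall x, ct_unitl C (ct_map eps (hom_id C) (Delta x)) = x;
  coalg_unitr : forall x, ct_unitr C (ct_map (hom_id C) eps (Delta x)) = x }.

(** [Delta] makes [C] a (cocommutative) topological coalgebra. *)
Definition coalgebra (C : topMod) (Delta : filtHom C (ctens C C)) :=
  exists eps, is_coalg Delta eps.

(** [Delta : A -> A (x)^ A] is a morphism of unital algebras, the product of
    the target being [(a (x) a') (b (x) b') = ab (x) a'b']. *)
Definition alg_comorphism (A : topAlg) (Delta : filtHom A (ctens A A)) :=
  Delta (ta_one A) = ct (ta_one A) (ta_one A) /\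
  forall a b, Delta (ta_mul A a b) =
              ct_bil (ta_mul A) (ta_mul A) (Delta a) (Delta b).

Record is_hopf (A : topAlg) (Delta : filtHom A (ctens A A)) (eps : filtHom A unit_obj)
    (S : filtHom A A) : Prop := IsHopf {
  hopf_coalg : is_coalg Delta eps;
  hopf_Delta : alg_comorphism Delta;
  hopf_eps1 : eps (ta_one A) = (1 : k);
  hopf_epsM : forall a b, eps (ta_mul A a b) = (eps a : k) * (eps b : k);
  hopf_Sl : forall a, ctlift_hom (ta_mul A) (ct_map S (hom_id A) (Delta a)) =
                      (eps a : k) *: ta_one A;
  hopf_Sr : forall a, ctlift_hom (ta_mul A) (ct_map (hom_id A) S (Delta a)) =
                      (eps a : k) *: ta_one A }.

(** [Delta] makes [A] a (cocommutative) topological Hopf algebra. *)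
Definition hopf_algebra (A : topAlg) (Delta : filtHom A (ctens A A)) :=
  exists eps S, is_hopf Delta eps S.

Section HatAlg.
Variables (A : filtMod) (mul : fbil A A A) (one : A).
Hypothesis algP : is_alg mul one.

Fact hat_algP : is_alg (hat_bil mul) (to_hat one).
Proof.
have sub0 m (x : A) : fil A m (x - x) by rewrite subrr; exact: sm0.
split=> [x y z|x|x]; apply: invlimP => m /=.
- apply/clsP; rewrite -(subrK (mul (lrep x m) (mul (lrep y m) (lrep z m))) (mul _ _)).
  rewrite -addrA; apply: smD; first by apply: fb_sub => //; exact: lrep_of.
  by rewrite (alg_mulA algP); apply: fb_sub => //; exact/smBC/lrep_of.
- rewrite -[RHS]repK; apply/clsP; rewrite -[X in _ - X](alg_mul1l algP).
  by apply: fb_sub => //; exact: lrep_of.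
rewrite -[RHS]repK; apply/clsP; rewrite -[X in _ - X](alg_mul1r algP).
by apply: fb_sub => //; exact: lrep_of.
Qed.
Definition hat_alg : topAlg := TopAlg hat_algP.
End HatAlg.

End FilteredModules.

Section FreeGroup.
Variable X : Type.

(** The letter [(x, true)] stands for the inverse of the generator [x]. *)
Definition word := seq (X * bool).
HB.instance Definition _ := gen_eqMixin word.
HB.instance Definition _ := gen_choiceMixin word.

Inductive word_eq : word -> word -> Prop :=
| word_eq_refl s : word_eq s s
| word_eq_sym s t : word_eq s t -> word_eq t s
| word_eq_trans s t u : word_eq s t -> word_eq t u -> word_eq s u
| word_eq_cancel s t x e : word_eq (s ++ (x, e) :: (x, ~~ e) :: t) (s ++ t).

Definition word_rel (s t : word) := `[< word_eq s t >].
Fact word_rel_refl : reflexive word_rel.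
Proof. by move=> s; apply/asboolP; exact: word_eq_refl. Qed.
Fact word_rel_sym : symmetric word_rel.
Proof. by move=> s t; apply/asboolP/asboolP; exact: word_eq_sym. Qed.
Fact word_rel_trans : transitive word_rel.
Proof.
by move=> t s u /asboolP st /asboolP tu; apply/asboolP; exact: word_eq_trans tu.
Qed.
Canonical word_equiv := EquivRel word_rel word_rel_refl word_rel_sym word_rel_trans.

Definition freeGroup : Type := {eq_quot word_rel}.
HB.instance Definition _ := Choice.on freeGroup.
HB.instance Definition _ := EqQuotient.on freeGroup.

Definition of_word (s : word) : freeGroup := \pi_freeGroup s.
Definition to_word (g : freeGroup) : word := repr g.

Lemma to_wordK g : of_word (to_word g) = g. Proof. exact: reprK. Qed.
Lemma of_wordP s t : of_word s = of_word t <-> word_eq s t.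
Proof.
split; first by move=> /eqquotP/asboolP.
by move=> st; apply/eqquotP/asboolP.
Qed.
Lemma to_of_word s : word_eq (to_word (of_word s)) s.
Proof. by apply/of_wordP; rewrite to_wordK. Qed.

Definition word_inv (s : word) : word := rev [seq (l.1, ~~ l.2) | l <- s].

Lemma word_eq_cat s s' t t' :
  word_eq s s' -> word_eq t t' -> word_eq (s ++ t) (s' ++ t').
Proof.
move=> ss' tt'; apply: (@word_eq_trans _ (s' ++ t)).
  elim: ss' t {t' tt'} => [u|u v _ IH|u v w _ IH _ IH'|u v x e] t.
  - exact: word_eq_refl.
  - exact/word_eq_sym.
  - exact: word_eq_trans (IH t) (IH' t).
  by rewrite -!catA; exact: word_eq_cancel.
elim: tt' => [u|u v _ IH|u v w _ IH _ IH'|u v x e].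
- exact: word_eq_refl.
- exact/word_eq_sym.
- exact: word_eq_trans IH IH'.
by rewrite !catA; exact: word_eq_cancel.
Qed.

Lemma word_invK : involutive word_inv.
Proof.
move=> s; rewrite /word_inv map_rev revK -map_comp -[RHS]map_id.
by apply: eq_map => -[x e] /=; rewrite negbK.
Qed.

Lemma word_eq_inv s t : word_eq s t -> word_eq (word_inv s) (word_inv t).
Proof.
elim=> [u|u v _ IH|u v w _ IH _ IH'|u v x e].
- exact: word_eq_refl.
- exact/word_eq_sym.
- exact: word_eq_trans IH IH'.
rewrite /word_inv !map_cat !rev_cat /= !rev_cons !cat_rcons negbK.
exact: word_eq_cancel.
Qed.

Lemma word_eq_mulV s : word_eq (s ++ word_inv s) [::].
Proof.
elim/last_ind: s => [|s [x e] IH]; first exact: word_eq_refl.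
rewrite /word_inv map_rcons rev_rcons cat_rcons.
exact: word_eq_trans (word_eq_cancel _ _ _ _) IH.
Qed.

Definition fg_one := of_word [::].
Definition fg_mul g h := of_word (to_word g ++ to_word h).
Definition fg_inv g := of_word (word_inv (to_word g)).

Lemma fg_mulE s t : fg_mul (of_word s) (of_word t) = of_word (s ++ t).
Proof. by apply/of_wordP/word_eq_cat; exact: to_of_word. Qed.
Lemma fg_invE s : fg_inv (of_word s) = of_word (word_inv s).
Proof. by apply/of_wordP/word_eq_inv; exact: to_of_word. Qed.
Lemma freeGroup_ind (Q : freeGroup -> Prop) :
  (forall s, Q (of_word s)) -> forall g, Q g.
Proof. by move=> H g; rewrite -(to_wordK g). Qed.

Fact fg_mulA : associative fg_mul.
Proof.
by elim/freeGroup_ind=> s; elim/freeGroup_ind=> t; elim/freeGroup_ind=> u;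
   rewrite !fg_mulE catA.
Qed.
Fact fg_mul1 : left_id fg_one fg_mul.
Proof. by elim/freeGroup_ind=> s; rewrite fg_mulE. Qed.
Fact fg_mulr1 : right_id fg_one fg_mul.
Proof. by elim/freeGroup_ind=> s; rewrite fg_mulE cats0. Qed.
Fact fg_mulrV : right_inverse fg_one fg_inv fg_mul.
Proof.
elim/freeGroup_ind=> s; rewrite fg_invE fg_mulE.
exact/of_wordP/word_eq_mulV.
Qed.
Fact fg_mulV : left_inverse fg_one fg_inv fg_mul.
Proof.
elim/freeGroup_ind=> s; rewrite fg_invE fg_mulE.
by apply/of_wordP; rewrite -{2}(word_invK s); exact: word_eq_mulV.
Qed.
HB.instance Definition _ :=
  isGroup.Build freeGroup fg_mulA fg_mul1 fg_mulr1 fg_mulV fg_mulrV.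

Definition fg_gen (x : X) : freeGroup := of_word [:: (x, false)].

Section Lift.
Variables (G : groupType) (f : X -> G).

Definition word_eval (s : word) : G :=
  (\prod_(l <- s) (if l.2 then (f l.1)^-1 else f l.1))%g.
Definition fg_lift (g : freeGroup) : G := word_eval (to_word g).

Lemma word_eval_eq s t : word_eq s t -> word_eval s = word_eval t.
Proof.
elim=> [//|u v _ -> //|u v w _ -> _ -> //|u v x e].
rewrite /word_eval !big_cat !big_cons /=; congr (_ * _)%g; rewrite mulgA.
by case: e; rewrite /= ?mulVg ?mulgV mul1g.
Qed.
Lemma fg_lift_word s : fg_lift (of_word s) = word_eval s.
Proof. exact/word_eval_eq/to_of_word. Qed.
Lemma fg_liftM g h : fg_lift (g * h)%g = (fg_lift g * fg_lift h)%g.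
Proof.
elim/freeGroup_ind: g => s; elim/freeGroup_ind: h => t.
by rewrite [(_ * _)%g]fg_mulE !fg_lift_word /word_eval big_cat.
Qed.
Lemma fg_lift_gen x : fg_lift (fg_gen x) = f x.
Proof. by rewrite fg_lift_word /word_eval big_seq1. Qed.
End Lift.

End FreeGroup.

Section GroupAlgebra.
Variables (k : comPzRingType) (G : groupType).

Definition galg : Type := freeMod k G.
HB.instance Definition _ := GRing.Lmodule.on galg.

Definition gone : galg := delta k (1%g : G).
(** The product of [G] extended bilinearly. *)
Definition gmul (a b : galg) : galg :=
  flift (fun g => flift (fun h => delta k (g * h)%g) b) a.

Lemma gmul_delta g h : gmul (delta k g) (delta k h) = delta k (g * h)%g.
Proof. by rewrite /gmul !flift_delta. Qed.
Lemma gmul_linl c a a' b : gmul (c *: a + a') b = c *: gmul a b + gmul a' b.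
Proof. exact: flift_linear. Qed.
Lemma gmul_linr c a b b' : gmul a (c *: b + b') = c *: gmul a b + gmul a b'.
Proof.
rewrite /gmul -flift_lin2; apply: flift_eq => g; exact: flift_linear.
Qed.
Lemma gmul0l b : gmul 0 b = 0. Proof. exact: linear0. Qed.
Lemma gmul0r a : gmul a 0 = 0.
Proof. by have := gmul_linr (-1) a 0 0; rewrite scaler0 addr0 scaleN1r addNr. Qed.

Fact gmulA : associative gmul.
Proof.
move=> a b c; elim/free_ind: a => [|x g a IHa]; first by rewrite !gmul0l.
rewrite !gmul_linl IHa; congr (_ *: _ + _) => {a IHa}.
elim/free_ind: b => [|y h b IHb]; first by rewrite !(gmul0l, gmul0r).
rewrite !(gmul_linl, gmul_linr) IHb; congr (_ *: _ + _) => {b IHb}.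
elim/free_ind: c => [|z l c IHc]; first by rewrite !gmul0r.
by rewrite !gmul_linr IHc !gmul_delta mulgA.
Qed.
Fact gmul1 : left_id gone gmul.
Proof.
move=> a; elim/free_ind: a => [|x g a IH]; first exact: gmul0r.
by rewrite gmul_linr IH gmul_delta mul1g.
Qed.
Fact gmulr1 : right_id gone gmul.
Proof.
move=> a; elim/free_ind: a => [|x g a IH]; first exact: gmul0l.
by rewrite gmul_linl IH gmul_delta mulg1.
Qed.
Fact gmulDl : left_distributive gmul +%R.
Proof. by move=> a b c; have := gmul_linl 1 a b c; rewrite !scale1r. Qed.
Fact gmulDr : right_distributive gmul +%R.
Proof. by move=> a b c; have := gmul_linr 1 a b c; rewrite !scale1r. Qed.
HB.instance Definition _ :=
  GRing.Zmodule_isPzRing.Build galg gmulA gmul1 gmulr1 gmulDl gmulDr.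

Lemma galg_scaleAl c (a b : galg) : c *: (a * b) = (c *: a) * b.
Proof. by have := gmul_linl c a 0 b; rewrite gmul0l !addr0. Qed.
Lemma galg_scaleAr c (a b : galg) : c *: (a * b) = a * (c *: b).
Proof. by have := gmul_linr c a b 0; rewrite gmul0r !addr0. Qed.

Definition ginj (g : G) : galg := delta k g.

End GroupAlgebra.
Arguments ginj k {G} g.

Definition galg_map (k : comPzRingType) (G H : groupType) (f : G -> H) :
  galg k G -> galg k H := flift (fun g => ginj k (f g)).
Arguments galg_map k {G H} f x.

Lemma galg_mapM (k : comPzRingType) (G H : groupType) (f : G -> H) :
  {morph f : x y / (x * y)%g} -> {morph galg_map k f : a b / a * b}.
Proof.
move=> fM a b; rewrite /galg_map -[a * b]/(gmul a b) -[RHS]/(gmul _ _).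
elim/free_ind: a => [|x g a IHa]; first by rewrite !(linear0, gmul0l).
rewrite linearP gmul_linl !linearP /= gmul_linl IHa.
congr (_ *: _ + _) => {a IHa}.
elim/free_ind: b => [|x' h b IHb]; first by rewrite !(linear0, gmul0r).
rewrite linearP gmul_linr !linearP /= gmul_linr IHb.
by congr (_ *: _ + _); rewrite gmul_delta !flift_delta gmul_delta fM.
Qed.

Section RootsOfUnity.
Variable N : nat.
Local Notation C := (Rdefinitions.R[i]).

(** The condition [z != 0] matters for [N = 0] only. *)
Record mu := Mu { mu_val : C; mu_valP : (mu_val != 0) && (mu_val ^+ N == 1) }.
HB.instance Definition _ := [isSub for mu_val].
HB.instance Definition _ := [Choice of mu by <:].

Lemma mu_neq0 (x : mu) : val x != 0. Proof. by case/andP: (valP x). Qed.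
Lemma mu_exp (x : mu) : val x ^+ N = 1. Proof. by case/andP: (valP x) => _ /eqP. Qed.

Fact mu_one_subproof : ((1 : C) != 0) && ((1 : C) ^+ N == 1).
Proof. by rewrite oner_eq0 expr1n eqxx. Qed.
Definition mu_one := Mu mu_one_subproof.
Fact mu_mul_subproof (x y : mu) :
  (val x * val y != 0) && ((val x * val y) ^+ N == 1).
Proof. by rewrite mulf_neq0 ?mu_neq0 // exprMn !mu_exp mulr1 eqxx. Qed.
Definition mu_mul x y := Mu (mu_mul_subproof x y).
Fact mu_inv_subproof (x : mu) :
  ((val x)^-1 != 0) && ((val x)^-1 ^+ N == 1).
Proof. by rewrite invr_neq0 ?mu_neq0 // exprVn mu_exp invr1 eqxx. Qed.
Definition mu_inv x := Mu (mu_inv_subproof x).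

Fact mu_mulA : associative mu_mul.
Proof. by move=> x y z; apply: val_inj; exact: mulrA. Qed.
Fact mu_mul1 : left_id mu_one mu_mul.
Proof. by move=> x; apply: val_inj; exact: mul1r. Qed.
Fact mu_mulr1 : right_id mu_one mu_mul.
Proof. by move=> x; apply: val_inj; exact: mulr1. Qed.
Fact mu_mulV : left_inverse mu_one mu_inv mu_mul.
Proof. by move=> x; apply: val_inj; apply: mulVf; exact: mu_neq0. Qed.
Fact mu_mulrV : right_inverse mu_one mu_inv mu_mul.
Proof. by move=> x; apply: val_inj; apply: mulfV; exact: mu_neq0. Qed.
HB.instance Definition _ :=
  isGroup.Build mu mu_mulA mu_mul1 mu_mulr1 mu_mulV mu_mulrV.

Definition cexpi (t : Rdefinitions.R) : C := (cos t +i* sin t)%C.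

Lemma cexpiX t n : cexpi t ^+ n = cexpi (t *+ n).
Proof.
elim: n => [|n IH]; first by rewrite expr0 mulr0n /cexpi cos0 sin0.
rewrite exprS IH mulrS /cexpi trigo.cosD trigo.sinD.
by rewrite [(sin t * _) + _]addrC.
Qed.

Lemma cexpi_neq0 t : cexpi t != 0.
Proof.
apply/negP; rewrite eq_complex /= => /andP[/eqP c0 /eqP s0].
have := trigo.cos2Dsin2 t; rewrite c0 s0 expr0n addr0 => /eqP.
by rewrite eq_sym oner_eq0.
Qed.

(** [e^(2 pi i / N)] *)
Definition zeta_val : C := cexpi (pi *+ 2 / N%:R).

Fact zeta_subproof : (zeta_val != 0) && (zeta_val ^+ N == 1).
Proof.
apply/andP; split.
  exact: cexpi_neq0.
have [->|N0] := posnP N; first by rewrite expr0.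
rewrite /zeta_val cexpiX -[_ *+ N]mulr_natr divfK ?pnatr_eq0 -?lt0n //.
by rewrite /cexpi cos2pi sin2pi.
Qed.
Definition zeta : mu := Mu zeta_subproof.

End RootsOfUnity.

Section Betti.
Variables (N : nat) (k : comPzRingType).

(** The generators [false] and [true] are [X_0] and [X_1]. *)
Definition F2 := freeGroup bool.
HB.instance Definition _ := Group.on F2.

Definition VB := galg k F2.
HB.instance Definition _ := GRing.PzRing.on VB.
HB.instance Definition _ := GRing.Lmodule.on VB.

Definition X0 : VB := ginj k (fg_gen false).
Definition X1 : VB := ginj k (fg_gen true).

Definition F2_to_mu : F2 -> mu N := fg_lift (fun x => if x then 1%g else zeta N).
Definition VB_to_mu : VB -> galg k (mu N) := galg_map k F2_to_mu.

Lemma VB_to_mu_linear : linear VB_to_mu.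
Proof. exact: flift_linear. Qed.

Fact augI_subproof : is_submod (fun x : VB => VB_to_mu x = 0).
Proof.
split=> [|c x y x0 y0]; first exact: linear0.
by rewrite VB_to_mu_linear x0 y0 scaler0 addr0.
Qed.
Definition augI : submod VB := Submod augI_subproof.

Inductive prod_set (P Q : submod VB) : VB -> Prop :=
  ProdSet x y of P x & Q y : prod_set P Q (x * y).
(** [I^m] *)
Fixpoint VB_fil (m : nat) : submod VB :=
  if m is n.+1 then lspan (prod_set (VB_fil n) augI) else full_submod VB.

Lemma VB_mulZDl c (x y z : VB) : (c *: x + y) * z = c *: (x * z) + y * z.
Proof. exact: gmul_linl. Qed.
Lemma VB_mulZDr c (x y z : VB) : x * (c *: y + z) = c *: (x * y) + x * z.
Proof. exact: gmul_linr. Qed.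

Lemma augI_mulr (x y : VB) : augI x -> augI (x * y).
Proof.
move=> x0; have -> : augI (x * y) = (VB_to_mu (x * y) = 0) by [].
by rewrite /VB_to_mu galg_mapM ?(x0 : galg_map _ _ _ = 0) ?mul0r //; exact: fg_liftM.
Qed.

Lemma VB_fil_mulr i (x y : VB) : VB_fil i x -> VB_fil i (x * y).
Proof.
case: i => [//|i] /=; elim=> [|c _ u [x1 z Fx1 Iz] _ IH].
  by rewrite mul0r; exact: in_lspan0.
rewrite VB_mulZDl; apply: (@smZD _ _ (VB_fil i.+1)) => //; rewrite -mulrA.
by apply: lspan_gen; apply: ProdSet => //; exact: augI_mulr.
Qed.

Lemma VB_fil_mul i j (x y : VB) :
  VB_fil i x -> VB_fil j y -> VB_fil (i + j) (x * y).
Proof.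
move=> Fx; elim: j y => [|j IH] y.
  by move=> _; rewrite addn0; exact: VB_fil_mulr.
rewrite addnS /=; elim=> [|c _ u [y1 z Fy1 Iz] _ IHu].
  by rewrite mulr0; exact: in_lspan0.
rewrite VB_mulZDr; apply: (@smZD _ _ (VB_fil (i + j).+1)) => //; rewrite mulrA.
by apply: lspan_gen; apply: ProdSet => //; exact: IH.
Qed.

Lemma VB_filS m (x : VB) : VB_fil m.+1 x -> VB_fil m x.
Proof.
by move=> /=; apply: lspan_min => _ [y z Fy _]; exact: VB_fil_mulr.
Qed.

Definition WB_set (x : VB) := exists (c : k) (v : VB), x = c *: (1 : VB) + v * (X1 - 1).

Fact WB_submod_subproof : is_submod WB_set.
Proof.
split=> [|c _ _ [a [v ->]] [b [w ->]]].
  by exists 0, 0; rewrite scale0r mul0r addr0.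
exists (c * a + b), (c *: v + w); rewrite VB_mulZDl scalerDl -scalerA scalerDr.
by rewrite addrACA.
Qed.
Definition WB_submod : submod VB := Submod WB_submod_subproof.
Definition WB := subm WB_submod.
HB.instance Definition _ := GRing.Lmodule.on WB.
Definition WB_val (x : WB) : VB := subm_val x.

Fact WB_fil_subproof m : is_submod (fun x : WB => VB_fil m (WB_val x)).
Proof.
split=> [|c x y Fx Fy]; first exact: sm0.
by rewrite /WB_val subm_valD subm_valZ; exact: smZD.
Qed.
Definition WB_fil m : submod WB := Submod (WB_fil_subproof m).
Fact WB_fil0 (x : WB) : WB_fil 0 x. Proof. by []. Qed.
Fact WB_filS m (x : WB) : WB_fil m.+1 x -> WB_fil m x.
Proof. exact: VB_filS. Qed.
Definition WB_filt : filtMod k := FiltMod WB_fil0 WB_filS.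

Lemma WB_valZD c (x y : WB_filt) : WB_val (c *: x + y) = c *: WB_val x + WB_val y.
Proof. by rewrite /WB_val subm_valD subm_valZ. Qed.

Fact WB_one_subproof : WB_set 1.
Proof. by exists 1, 0; rewrite scale1r mul0r addr0. Qed.
Definition WB_one : WB_filt := insubm (WB_one_subproof : WB_submod 1).
Fact WB_mul_subproof (x y : WB) : WB_set (WB_val x * WB_val y).
Proof.
have WBP (z : WB) : WB_set (WB_val z) := submP z.
have [[a [v ->]] [b [w ->]]] := (WBP x, WBP y).
exists (a * b), (a *: w + (b *: v + v * (X1 - 1) * w)).
rewrite VB_mulZDl mul1r VB_mulZDr mulr1 scalerDr scalerA.
by rewrite -addrA; congr (_ + _); rewrite VB_mulZDl VB_mulZDl !mulrA.
Qed.
Definition WB_mul (x y : WB_filt) : WB_filt :=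
  insubm (WB_mul_subproof x y : WB_submod _).

Fact WB_mulP : bilin_deg 0 WB_mul.
Proof.
split=> [y c x x'|x c y y'|i j x y Fx Fy].
- apply: subm_inj; rewrite -[LHS]/(WB_val (c *: x + x') * WB_val y).
  by rewrite -[RHS]/(WB_val (c *: WB_mul x y + WB_mul x' y)) !WB_valZD VB_mulZDl.
- apply: subm_inj; rewrite -[LHS]/(WB_val x * WB_val (c *: y + y')).
  by rewrite -[RHS]/(WB_val (c *: WB_mul x y + WB_mul x y')) !WB_valZD VB_mulZDr.
by rewrite addn0; exact: VB_fil_mul.
Qed.
Definition WB_bil : fbil WB_filt WB_filt WB_filt := Fbil WB_mulP.

Fact WB_algP : is_alg WB_bil WB_one.
Proof.
split=> [x y z|x|x]; apply: subm_inj; [exact: mulrA | exact: mul1r | exact: mulr1].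
Qed.

Definition WBhat : topAlg k := hat_alg WB_algP.

Definition VX0_set (x : VB) := exists v : VB, x = v * (X0 - 1).
Fact VX0_submod_subproof : is_submod VX0_set.
Proof.
split=> [|c _ _ [v ->] [w ->]]; first by exists 0; rewrite mul0r.
by exists (c *: v + w); rewrite VB_mulZDl.
Qed.
Definition VX0_submod : submod VB := Submod VX0_submod_subproof.

Definition MB := quo VX0_submod.
HB.instance Definition _ := GRing.Lmodule.on MB.
Definition MB_cls (v : VB) : MB := cls VX0_submod v.
Definition MB_one : MB := MB_cls 1.

Definition VB_act (v : VB) (q : MB) : MB := MB_cls (v * rep q).

Lemma VB_actE v w : VB_act v (MB_cls w) = MB_cls (v * w).
Proof.
apply/clsP; rewrite -mulrBr; have [u ->] := rep_cls VX0_submod w.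
by exists (v * u); rewrite mulrA.
Qed.

Fact MB_fil_subproof m :
  is_submod (fun q : MB => exists2 w : WB, WB_fil m w & q = VB_act (WB_val w) MB_one).
Proof.
split=> [|c _ _ [v Fv ->] [w Fw ->]].
  by exists 0; [exact: sm0 | rewrite VB_actE mulr1 /MB_cls linear0].
exists (c *: v + w); first exact: smZD.
rewrite !VB_actE !mulr1 /MB_cls -linearP /WB_val subm_valD subm_valZ.
by [].
Qed.
(** [F^m W . 1_B] *)
Definition MB_fil m : submod MB := Submod (MB_fil_subproof m).

Lemma MB_filP m (q : MB) :
  MB_fil m q <-> exists2 w : WB, WB_fil m w & q = MB_cls (WB_val w).
Proof. by split=> -[w Fw ->]; exists w; rewrite // VB_actE mulr1. Qed.

(** [V = W + V (X_0 - 1)] *)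
Lemma VB_decomp (v : VB) : exists2 w : WB, True & VX0_submod (v - WB_val w).
Proof.
suff [c [a [b ->]]] : exists (c : k) (a b : VB),
    v = c *: (1 : VB) + a * (X1 - 1) + b * (X0 - 1).
  have Ww : WB_submod (c *: (1 : VB) + a * (X1 - 1)) by exists c, a.
  by exists (insubm Ww) => //; exists b; rewrite /= addrC addKr.
elim/free_ind: v => [|x g v [c [a [b IH]]]].
  by exists 0, 0, 0; rewrite scale0r !mul0r !addr0.
suff [c' [a' [b' E]]] : exists (c : k) (a b : VB),
    ginj k g = c *: (1 : VB) + a * (X1 - 1) + b * (X0 - 1).
  exists (x * c' + c), (x *: a' + a), (x *: b' + b).
  rewrite {1}(E : delta k g = _) IH !VB_mulZDl scalerDl -scalerA !scalerDr.
  by rewrite addrACA [X in X + _ = _]addrACA.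
move: g {x v c a b IH}; elim/freeGroup_ind => s; elim/last_ind: s => [|s [e b] [c [a' [b' IH]]]].
  by exists 1, 0, 0; rewrite scale1r !mul0r !addr0.
have gM (g h : F2) : ginj k (g * h)%g = (ginj k g : VB) * ginj k h.
  by rewrite -[RHS]/(gmul _ _) gmul_delta.
have step (g h : F2) : ginj k (g * h)%g = ginj k g + ginj k g * (ginj k h - 1) :> VB.
  by rewrite gM mulrBr mulr1 addrCA subrr addr0.
have stepV (g h : F2) :
    ginj k (g * h^-1)%g = ginj k g - ginj k (g * h^-1)%g * (ginj k h - 1) :> VB.
  by rewrite mulrBr mulr1 -gM mulgVK opprB addrCA subrr addr0.
have -> : of_word (rcons s (e, b)) =
    (of_word s * if b then (fg_gen e)^-1 else fg_gen e)%g :> F2.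
  rewrite -cats1 -fg_mulE; congr (_ * _)%g; case: (b) => //.
  by rewrite [RHS]fg_invE.
have [u ->] : exists u : VB,
    ginj k (of_word s * if b then (fg_gen e)^-1 else fg_gen e)%g =
    ginj k (of_word s : F2) + u * (ginj k (fg_gen e) - 1) :> VB.
  case: b; last by exists (ginj k (of_word s : F2)); exact: step.
  exists (- ginj k (of_word s * (fg_gen e)^-1 : F2)%g); rewrite mulNr.
  exact: stepV.
have addAAC (U : zmodType) (p q r t : U) : p + q + r + t = p + (q + t) + r.
  by rewrite (addrA p q t) (addrAC (p + q) t r).
rewrite IH; case: e.
  by exists c, (a' + u), b'; rewrite (mulrDl a' u); exact: addAAC.
by exists c, a', (b' + u); rewrite (mulrDl b' u); exact/esym/addrA.
Qed.

Fact MB_fil0 (q : MB) : MB_fil 0 q.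
Proof.
elim/quo_ind: q => v; apply/MB_filP; have [w _ vw] := VB_decomp v.
by exists w => //; apply/clsP.
Qed.
Fact MB_filS m (q : MB) : MB_fil m.+1 q -> MB_fil m q.
Proof. by move=> [w /WB_filS Fw ->]; exists w. Qed.
Definition MB_filt : filtMod k := FiltMod MB_fil0 MB_filS.
Definition MBhat : topMod k := hat MB_filt.

Definition WB_act (w : WB_filt) (q : MB_filt) : MB_filt := VB_act (WB_val w) q.

Fact WB_actP : bilin_deg 0 WB_act.
Proof.
split=> [q c w w'|w c|i j w q Fw /MB_filP [w' Fw' ->]].
- rewrite /WB_act /VB_act /WB_val subm_valD subm_valZ VB_mulZDl.
  exact: cls_linear.
- elim/quo_ind=> x; elim/quo_ind=> y.
  by rewrite -linearP /WB_act !VB_actE VB_mulZDr; exact: cls_linear.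
rewrite addn0; apply/MB_filP; exists (WB_mul w w'); first exact: VB_fil_mul.
exact: VB_actE.
Qed.
Definition WB_act_bil : fbil WB_filt MB_filt MB_filt := Fbil WB_actP.
Definition WBhat_act : fbil WBhat MBhat MBhat := hat_bil WB_act_bil.

Lemma WB_actA (a b : WB_filt) q : WB_act (WB_bil a b) q = WB_act a (WB_act b q).
Proof.
elim/quo_ind: q => v; rewrite /WB_act -[cls _ v]/(MB_cls v) !VB_actE; congr MB_cls.
exact/esym/(mulrA (WB_val a) (WB_val b) v).
Qed.
Lemma WB_act1 q : WB_act WB_one q = q.
Proof.
elim/quo_ind: q => v; rewrite /WB_act -[cls _ v]/(MB_cls v) VB_actE; congr MB_cls.
exact: (mul1r (v : VB)).
Qed.

End Betti.

(* Main.v *)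
Require Import Defs.
From mathcomp Require Import all_boot all_order all_algebra.
From mathcomp Require Import boolp classical_sets Rstruct reals trigo complex.

Set Implicit Arguments.
Unset Strict Implicit.
Unset Printing Implicit Defensive.

Import Order.TTheory GRing.Theory Num.Theory.
Local Open Scope ring_scope.

(** The completed algebra W is topologically free on the closed span of the
    elements y_i = X_0^i (X_1 - 1), i in Z: for every complete
    filtered module P, every filtered bilinear map A : W x P -> P and every p_0
    in P there is exactly one filtered linear map f : W -> P with f(1) = p_0
    and f(y_i x) = A(y_i, f(x)), and M has the same property with the class
    1_B in place of 1.  Existence is [WBhat_recursion] and [MBhat_recursion],
    uniqueness is [WBhat_ext] and [MBhat_ext].

    Granting this, the Hopf algebra structure is the one in which all the y_i
    are primitive.  The coproduct is given by A(a, t) = (a (x) 1 + 1 (x) a) t,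
    both on W and on M, the counit by A = 0 and the antipode by
    A(a, x) = - x a.  Each axiom is an equality of two filtered linear maps on
    W or M; both sides take the same value at the generator 1 or 1_B and are
    intertwined with the y_i in the same way, so uniqueness gives the equality.

    Existence is the substance ([VB_recursion]).  Writing h(i) = f(X_0^i v), the
    recursion forces the group F_2 to act on functions h : Z -> P by
      (X_0 h)(i) = h(i + 1),   (X_1 h)(i) = h(i) + A(y_i, h(0)),
    where X_1 is invertible because 1 + A(y_0, -) is, by a geometric series.
    Conversely this action defines f(v) as the value at 0 of v applied to the
    constant function p_0; since X_0 fixes constants, f kills V (X_0 - 1) and
    descends to M.  The map f respects the filtrations because functions whose
    n-th differences of step N lie in F^(m + n) P, for all n, form a filtration
    that the ideal I shifts by one: on its graded pieces X_1 acts trivially and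
    X_0 as the shift of Z/N, so the action factors through mu_N.

    Uniqueness is a density statement ([WB_dense]): modulo I^m, inverting X_1
    is again a finite geometric series, and left multiplication by X_0^(+-1)
    permutes the y_i. *)

(** * Filtered linear maps and density *)

Section FilteredMaps.
Variable k : comPzRingType.

Lemma linear_sub (A B : lmodType k) (f : A -> B) : linear f ->
  forall x y, f (x - y) = f x - f y.
Proof. by move=> lf; case: (lin_raw lf) => [[_ ?] _]. Qed.

Lemma lin_deg_comp (A B C : filtMod k) s t (f : A -> B) (g : B -> C) :
  lin_deg s f -> lin_deg t g -> lin_deg (s + t) (fun x => g (f x)).
Proof.
move=> [lf df] [lg dg]; split=> [c x y|m x Fx]; first by rewrite lf lg.
by rewrite addnA; apply/dg/df.
Qed.

Lemma lin_deg_id (A : filtMod k) : lin_deg 0 (fun x : A => x).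
Proof. by split=> // m x Fx; rewrite addn0. Qed.

Lemma lin_deg_hom (A B C : filtMod k) s (f : A -> B) (g : filtHom B C) :
  lin_deg s f -> lin_deg s (fun x => g (f x)).
Proof.
move=> [lf df]; split=> [c x y|m x /df]; last exact: hom_fil.
by rewrite lf hom_linear.
Qed.

Lemma lin_deg_bill (A B C D : filtMod k) s (f : A -> B) (b : fbil B C D) y :
  lin_deg s f -> lin_deg s (fun x => b (f x) y).
Proof.
move=> [lf df]; split=> [c x x'|m x /df Fx]; first by rewrite lf fb_linl.
by rewrite -[(m + s)%N]addn0; apply: fb_fil => //; exact: fil0.
Qed.

Lemma lin_deg_bilr (A B C D : filtMod k) s (f : A -> C) (b : fbil B C D) x :
  lin_deg s f -> lin_deg s (fun y => b x (f y)).
Proof.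
move=> [lf df]; split=> [c y y'|m y /df Fy]; first by rewrite lf fb_linr.
by rewrite -[(m + s)%N]add0n; apply: fb_fil => //; exact: fil0.
Qed.

Definition ct_fbil (A B : filtMod k) : fbil A B (ctens A B) := Fbil (@ct_deg k A B).

Lemma lin_deg_ctl (A B C : filtMod k) s (f : A -> B) (y : C) :
  lin_deg s f -> lin_deg s (fun x => ct (f x) y).
Proof. exact: (lin_deg_bill (ct_fbil B C)). Qed.

Lemma lin_deg_ctr (A B C : filtMod k) s (f : A -> C) (x : B) :
  lin_deg s f -> lin_deg s (fun y => ct x (f y)).
Proof. exact: (lin_deg_bilr (ct_fbil B C)). Qed.

Lemma lin_degD (A B : filtMod k) s (f g : A -> B) :
  lin_deg s f -> lin_deg s g -> lin_deg s (fun x => f x + g x).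
Proof.
move=> [lf df] [lg dg]; split=> [c x y|m x Fx]; last by apply: smD; auto.
by rewrite lf lg scalerDr addrACA.
Qed.

Lemma lin_degB (A B : filtMod k) s (f g : A -> B) :
  lin_deg s f -> lin_deg s g -> lin_deg s (fun x => f x - g x).
Proof.
move=> [lf df] [lg dg]; split=> [c x y|m x Fx]; last by apply: smB; auto.
by rewrite lf lg scalerBr opprD addrACA.
Qed.

(** A filtered map into a separated module is determined by approximations of
    its argument. *)
Lemma lin_deg_eq_approx (A : filtMod k) (P : topMod k) s t (f g : A -> P) x :
    lin_deg s f -> lin_deg t g ->
  (forall m, exists2 y, f y = g y & fil A m (x - y)) -> f x = g x.
Proof.
move=> [lf df] [lg dg] H; apply/subr0_eq/tm_separated => m.
have [y fgy Fxy] := H m.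
have -> : f x - g x = f (x - y) - g (x - y).
  by rewrite (linear_sub lf) (linear_sub lg) fgy opprB addrA subrK.
by apply: smB; [apply: (@fil_le _ _ _ (m + s)); [exact: leq_addr | exact: df]
               |apply: (@fil_le _ _ _ (m + t)); [exact: leq_addr | exact: dg]].
Qed.

Lemma hat_approx (A : filtMod k) (x : hat A) m :
  fil (hat A) m (x - to_hat (lrep x m)).
Proof. by apply/invlim_fil_sub/smBC; exact: (rep_cls (fil A m) (lrep x m)). Qed.

Lemma hat_ext (A : filtMod k) (P : topMod k) s t (f g : hat A -> P) :
    lin_deg s f -> lin_deg t g ->
  (forall a, f (to_hat a) = g (to_hat a)) -> f =1 g.
Proof.
move=> fP gP E x; apply: (lin_deg_eq_approx fP gP) => m.
by exists (to_hat (lrep x m)); [exact: E | exact: hat_approx].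
Qed.

(** The form in which all identities on completed tensor products are checked:
    it is enough to look at pure tensors. *)
Lemma ctens_ext (A B : filtMod k) (P : topMod k) s t (f g : ctens A B -> P) :
    lin_deg s f -> lin_deg t g ->
  (forall a b, f (ct a b) = g (ct a b)) -> f =1 g.
Proof.
move=> fP gP E; apply: (hat_ext fP gP); elim/tens_ind => [|c a b u IH].
  have -> : to_hat (0 : tens A B) = 0 by rewrite (lin_raw (@to_hat_linear _ _)).
  by rewrite (lin_raw fP.1) (lin_raw gP.1).
by rewrite to_hat_linear fP.1 gP.1 IH; congr (_ *: _ + _); exact: E.
Qed.

Lemma ct_mapE (A A' B B' : filtMod k) (f : filtHom A A') (g : filtHom B B') a b :
  ct_map f g (ct a b) = ct (f a) (g b).
Proof. exact: (ctlift_pure a b (ct_map_fbilP f g)). Qed.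

Lemma ct_swapE (A B : filtMod k) (a : A) (b : B) : ct_swap A B (ct a b) = ct b a.
Proof. exact: (ctlift_pure a b (@ct_swapP _ A B)). Qed.

Lemma ctlift_homE (A B : filtMod k) (P : topMod k) (b : fbil A B P) x y :
  ctlift_hom b (ct x y) = b x y.
Proof. exact: (ctlift_pure x y (fbP b)). Qed.

Lemma ct_unitlE (A : topMod k) (c : k) (x : A) :
  ct_unitl A (ct (c : unit_obj k) x) = c *: x.
Proof. exact: (ctlift_pure _ x (unit_lP A)). Qed.

Lemma ct_unitrE (A : topMod k) (x : A) (c : k) :
  ct_unitr A (ct x (c : unit_obj k)) = c *: x.
Proof. exact: (ctlift_pure x _ (unit_rP A)). Qed.

(** If [B] raises the filtration by one, [1 + B] is invertible on a complete
    separated module. *)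
Section Geometric.
Variables (P : topMod k) (B : P -> P).
Hypothesis BP : lin_deg 1 B.

Lemma addB_fil m x : fil P m (x + B x) -> fil P m x.
Proof.
move=> Fx; suff H j : (j <= m)%N -> fil P j x by exact: H.
elim: j => [|j IH] jm; first exact: fil0.
rewrite -(addrK (B x) x); apply: smB; first exact: fil_le Fx.
by rewrite -addn1; case: BP => _; apply; apply/IH/ltnW.
Qed.

(** The solution is the limit of the iterates of [b |-> x - B b], that is, of the
    partial sums of the geometric series. *)
Lemma addB_surj x : exists b, b + B b = x.
Proof.
pose u := fix u m := if m is n.+1 then x - B (u n) else 0.
have [lB dB] := BP.
have uP : forall m, fil P m (u m.+1 - u m).
  elim=> [|m IH]; first exact: fil0.
  rewrite -[u m.+1]/(x - B (u m)) -[u m.+2]/(x - B (u m.+1)).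
  by rewrite opprB addrC addrA subrK -(linear_sub lB) -[X in fil _ X]addn1; apply/dB/smBC.
have [b bP] := tm_complete uP; exists b.
apply/subr0_eq/tm_separated => m.
have -> : b + B b - x = (b - u m.+1) + B (b - u m).
  by rewrite (linear_sub lB) /= opprB addrACA [B (u m) - x - _]addrAC subrr add0r.
apply: smD; first by apply: filS; exact: bP.
by apply: filS; rewrite -[m.+1]addn1; apply: dB.
Qed.

Lemma geometric_inverse : exists inv : P -> P,
  [/\ lin_deg 0 inv, forall x, inv x + B (inv x) = x & forall x, inv (x + B x) = x].
Proof.
have [inv invP] := choice addB_surj; exists inv.
have inj a b : a + B a = b + B b -> a = b.
  move=> E; apply/subr0_eq/tm_separated => m; apply: addB_fil.
  by rewrite (linear_sub BP.1) addrACA -opprD E subrr; exact: sm0.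
split=> // [|x]; last exact: inj.
split=> [c x y|m x Fx].
  apply: inj; rewrite invP BP.1 addrACA -scalerDr !invP.
  by [].
by rewrite addn0; apply: addB_fil; rewrite invP.
Qed.

End Geometric.
End FilteredMaps.

(** Decides that a composite of morphisms, partially applied bilinear maps, pure
    tensors, sums and differences is filtered. *)
Ltac lin_deg_auto := repeat
  lazymatch goal with
  | |- lin_deg _ (fun x => @?f x - @?g x) => apply: lin_degB
  | |- lin_deg _ (fun x => @?f x + @?g x) => apply: lin_degD
  | |- _ => first [ exact: lin_deg_id | apply: lin_deg_hom | apply: lin_deg_bill
                  | apply: lin_deg_bilr | apply: lin_deg_ctl | apply: lin_deg_ctr ]
  end.

(** * The order of the root of unity *)

Section Zeta.
Variable N : nat.
Hypothesis N_gt0 : (0 < N)%N.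
Local Notation C := (Rdefinitions.R[i]).

(** The real part 1 = cos (2 t) = 1 - 2 (sin t)^2 excludes exponents [0 < r < N],
    for which [0 < t < pi]. *)
Lemma zeta_exp_eq1 n : zeta_val N ^+ n = 1 -> (N %| n)%N.
Proof.
move=> zn; rewrite /dvdn; set r := (n %% N)%N.
have zN : zeta_val N ^+ N = 1 := mu_exp (zeta N).
have {zn} : zeta_val N ^+ r = 1.
  by move: zn; rewrite {1}(divn_eq n N) exprD mulnC exprM zN expr1n mul1r.
rewrite /zeta_val cexpiX => /(congr1 (fun z : C => complex.Re z)) /=.
have rN : (r < N)%N by rewrite ltn_mod.
case: (posnP r) => [-> //|r0] c1; exfalso.
pose t : Rdefinitions.R := pi * (r%:R / N%:R).
have halve (F : fieldType) (p q : F) m : p *+ 2 / q *+ m = (p * (m%:R / q)) *+ 2.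
    rewrite -[LHS]mulr_natr -[p *+ 2]mulr_natr -[RHS]mulr_natr -!mulrA.
    by congr (_ * _); rewrite mulrC -mulrA mulrCA.
  have et : pi *+ 2 / N%:R *+ r = t *+ 2 :> Rdefinitions.R := halve _ _ _ _.
  have N0 : 0 < N%:R :> Rdefinitions.R by rewrite ltr0n.
have st : 0 < sin t.
  apply: sin_gt0_pi; rewrite mulr_gt0 ?pi_gt0 ?divr_gt0 ?ltr0n //=.
  by rewrite -[ltRHS]mulr1 ltr_pM2l ?pi_gt0 // ltr_pdivrMr // mul1r ltr_nat.
move: c1; rewrite et cos_mulr2n => /eqP; rewrite subr_eq -mulr2n eqr_pMn2r // => /eqP c1.
by have := cos2Dsin2 t; rewrite c1 -[RHS]addr0 => /addrI/eqP; rewrite expf_eq0 (gt_eqF st).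
Qed.

End Zeta.

(** * The generators X_0^i (X_1 - 1) *)

Section Generators.
Variables (N : nat) (k : comPzRingType).
Local Notation VB := (VB k).

(** The exponent of the generator X_0 in the abelianization of the free group. *)
Definition X0_deg (s : word bool) : int :=
  \sum_(l <- s) (if l.1 then 0 else if l.2 then -1 else 1).

Lemma F2_to_mu_word s : val (F2_to_mu N (of_word s)) = zeta_val N ^ X0_deg s.
Proof.
rewrite /F2_to_mu fg_lift_word /X0_deg /word_eval.
elim: s => [|[[] e] s IH]; rewrite ?big_nil ?expr0z // !big_cons /=.
  by rewrite add0r -IH; case: e; rewrite ?mulg1 ?mul1g //= /mu_inv /= ?invr1 ?mul1r.
rewrite expfzDr ?cexpi_neq0 // -IH; case: e => //=.
Qed.

Lemma X0_deg_congr s t : (0 < N)%N -> F2_to_mu N (of_word s) = F2_to_mu N (of_word t) ->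
  exists d : int, X0_deg s = X0_deg t + d * N.
Proof.
move=> N_gt0 /(congr1 val); rewrite !F2_to_mu_word => E.
have z0 : zeta_val N != 0 := cexpi_neq0 _.
have : zeta_val N ^ (X0_deg s - X0_deg t) = 1.
  by rewrite expfzDr // E -expfzDr // subrr.
suff H d : zeta_val N ^ d = 1 -> exists e, d = e * N%:Z.
  by move=> /H[e /eqP]; rewrite subr_eq => /eqP ->; exists e; rewrite addrC.
have Hn n : zeta_val N ^+ n = 1 -> exists e, n%:Z = e * N%:Z.
  by move=> /(zeta_exp_eq1 N_gt0)/dvdnP[e ->]; exists e%:Z; rewrite PoszM.
case: d => n; first exact: Hn.
rewrite /exprz => /(congr1 GRing.inv); rewrite invrK invr1 NegzE => /Hn[e ->].
by exists (- e); rewrite mulNr.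
Qed.

Lemma ginjM (g h : F2) : ginj k (g * h)%g = (ginj k g : VB) * ginj k h.
Proof. by rewrite -[RHS]/(gmul _ _) gmul_delta. Qed.

Definition X0V : VB := ginj k (fg_gen false)^-1%g.
Definition X1V : VB := ginj k (fg_gen true)^-1%g.

Lemma X0K : X0V * X0 k = 1 :> VB. Proof. by rewrite -ginjM mulVg. Qed.
Lemma X0VK : X0 k * X0V = 1 :> VB. Proof. by rewrite -ginjM mulgV. Qed.
Lemma X1K : X1V * X1 k = 1 :> VB. Proof. by rewrite -ginjM mulVg. Qed.

Definition X0z (i : int) : VB :=
  match i with Posz n => X0 k ^+ n | Negz n => X0V ^+ n.+1 end.

Lemma X0zS i : X0z (i + 1) = X0 k * X0z i.
Proof.
case: i => n; first by rewrite -PoszD addn1 /= exprS.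
rewrite NegzE; case: n => [|n]; first by rewrite addNr /= expr0 expr1 X0VK.
rewrite (_ : - n.+2%:Z + 1 = Negz n); last by rewrite NegzE -addn1 PoszD opprD addrK.
by rewrite -NegzE /= [X0V ^+ n.+2]exprS mulrA X0VK mul1r.
Qed.
Lemma X0zP i : X0z (i - 1) = X0V * X0z i.
Proof. by rewrite -[in RHS](subrK 1 i) X0zS mulrA X0K mul1r. Qed.

Lemma X0zD i j : X0z (i + j) = X0z i * X0z j.
Proof.
elim/int_rect: i => [|n IH|n IH]; first by rewrite add0r mul1r.
  by rewrite -[n.+1]addn1 PoszD addrAC !X0zS IH mulrA.
by rewrite -[n.+1]addn1 PoszD opprD addrAC !X0zP IH mulrA.
Qed.

Fact gen_subproof i : WB_submod k (X0z i * (X1 k - 1)).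
Proof. by exists 0, (X0z i); rewrite scale0r add0r. Qed.
Definition gen (i : int) : WB_filt N k := insubm (gen_subproof i).

(** The difference operator of step N, which records multiplication by X_0^N - 1,
    an element of the ideal I. *)
Definition diff (V : zmodType) (h : int -> V) : int -> V := fun i => h (i + N) - h i.

Lemma augI_X (g : F2) : F2_to_mu N g = 1%g -> augI N k ((ginj k g : VB) - 1).
Proof.
move=> g1; rewrite /augI /= /VB_to_mu /galg_map linearB /= !flift_delta g1.
by rewrite /F2_to_mu fg_lift_word /word_eval big_nil subrr.
Qed.

Lemma augI_X1 : augI N k (X1 k - 1).
Proof. by apply: augI_X; rewrite /F2_to_mu fg_lift_gen. Qed.

Lemma augI_X0N : augI N k (X0z N - 1).
Proof.
have -> : X0z N = ginj k (of_word (nseq N (false, false))) :> VB.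
  rewrite /X0z; elim: N => [|n IH] //=.
  by rewrite exprS IH -ginjM [(_ * _)%g]fg_mulE.
apply: augI_X; apply: val_inj; rewrite F2_to_mu_word /X0_deg big_nseq /=.
by rewrite iter_addr addr0 natz -exprnP; exact: (mu_exp (zeta N)).
Qed.

Lemma gen_diff n i :
  WB_val (iter n (@diff (WB_filt N k)) gen i) = X0z i * (X0z N - 1) ^+ n * (X1 k - 1).
Proof.
elim: n i => [|n IH] i; first by rewrite expr0 mulr1.
rewrite iterS /diff /WB_val subm_valB -!/(WB_val _) !IH X0zD -!mulrBl; congr (_ * _).
by rewrite exprS mulrA mulrBr mulr1.
Qed.

(** The n-th difference of the generators is X_0^i (X_0^N - 1)^n (X_1 - 1), a
    multiple of n + 1 elements of I. *)
Lemma gen_smooth n i : WB_fil N k n.+1 (iter n (@diff (WB_filt N k)) gen i).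
Proof.
have F1 x : augI N k x -> VB_fil N k 1 x.
  by move=> Ix; rewrite -[x]mul1r; apply: lspan_gen; apply: ProdSet.
suff: VB_fil N k (n + 1) (WB_val (iter n (@diff (WB_filt N k)) gen i)) by rewrite addn1.
rewrite gen_diff; apply: VB_fil_mul; last exact/F1/augI_X1.
elim: n => [|n IH] //; rewrite exprSr mulrA -[n.+1]addn1; apply: VB_fil_mul => //.
exact/F1/augI_X0N.
Qed.

End Generators.

(** * The recursion principle *)

(** [inv] is the inverse of the operator [1 + A(y_0, -)] of [P]. *)
Section Recursion.
Variables (N : nat) (k : comPzRingType).
Hypothesis N_gt0 : (0 < N)%N.
Local Notation VB := (VB k).
Variables (P : topMod k) (A : fbil (WB_filt N k) P P) (inv : P -> P).
Hypothesis inv_fil : forall m x, fil P m x -> fil P m (inv x).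
Hypothesis inv_linear : linear inv.
Hypothesis invr : forall x, inv x + A (gen N k 0) (inv x) = x.
Hypothesis invl : forall x, inv (x + A (gen N k 0) x) = x.

Local Notation H := (int -> P).
Local Notation gen := (gen N k).

(** The action forced by h(i) = f(X_0^i v); the letter [(x, true)] acts by the
    inverse of the operator of [(x, false)]. *)
Definition act_letter (l : bool * bool) (h : H) : H := fun i =>
  match l with
  | (false, e) => h (i + (if e then -1 else 1))
  | (true, false) => h i + A (gen i) (h 0)
  | (true, true) => h i - A (gen i) (inv (h 0))
  end.
Definition act_word (s : word bool) (h : H) : H := foldr act_letter h s.

Lemma act_letterK x e h : act_letter (x, e) (act_letter (x, ~~ e) h) = h.
Proof.
apply/funext => i; case: x e => [] [] /=.
- by rewrite invl addrK.
- have -> : h 0 - A (gen 0) (inv (h 0)) = inv (h 0) by rewrite -{1}[h 0]invr addrK.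
  by rewrite subrK.
- by rewrite addrNK.
- by rewrite addrK.
Qed.

Lemma act_word_eq s t : word_eq s t -> act_word s =1 act_word t.
Proof.
elim=> [//|u v _ IH h|u v w _ IH _ IH' h|u v x e h]; first by rewrite IH.
  by rewrite IH.
by rewrite /act_word !foldr_cat /= act_letterK.
Qed.

Definition act_F2 (g : F2) : H -> H := act_word (to_word g).
Lemma act_F2_word s : act_F2 (of_word s) =1 act_word s.
Proof. exact/act_word_eq/to_of_word. Qed.
Lemma act_F2M g g' h : act_F2 (g * g')%g h = act_F2 g (act_F2 g' h).
Proof.
elim/freeGroup_ind: g => s; elim/freeGroup_ind: g' => t.
by rewrite [(_ * _)%g]fg_mulE !act_F2_word /act_word foldr_cat.
Qed.

Definition hlin c (h h' : H) : H := fun i => c *: h i + h' i.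

Lemma act_letter_lin l c h h' :
  act_letter l (hlin c h h') = hlin c (act_letter l h) (act_letter l h').
Proof.
apply/funext => i; case: l => [[] []] //=; rewrite /hlin.
  by rewrite inv_linear fb_linr scalerBr opprD addrACA.
by rewrite fb_linr scalerDr addrACA.
Qed.

Lemma act_F2_lin g c h h' : act_F2 g (hlin c h h') = hlin c (act_F2 g h) (act_F2 g h').
Proof.
by rewrite /act_F2 /act_word; elim: (to_word g) => //= l s ->; exact: act_letter_lin.
Qed.

Definition act (v : VB) (h : H) : H := fun i => flift (fun g => act_F2 g h i) v.

Lemma act_ginj g h : act (ginj k g) h = act_F2 g h.
Proof. by apply/funext => i; exact: flift_delta. Qed.
Lemma act_linl c v w h : act (c *: v + w) h = hlin c (act v h) (act w h).
Proof. by apply/funext => i; exact: flift_linear. Qed.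
Lemma act_linr v c h h' : act v (hlin c h h') = hlin c (act v h) (act v h').
Proof.
apply/funext => i; rewrite /act /hlin -flift_lin2.
by apply: flift_eq => g; rewrite act_F2_lin.
Qed.
Lemma act0l h : act 0 h = fun=> 0.
Proof. by apply/funext => i; rewrite /act linear0. Qed.
Lemma act0r v : act v (fun=> 0) = fun=> 0.
Proof.
have E : (fun=> 0) = hlin 0 (fun=> 0) (fun=> 0) :> H.
  by apply/funext => i; rewrite /hlin scaler0 addr0.
have := act_linr v (-1) (fun=> 0) (fun=> 0).
have -> : hlin (-1) (fun=> 0) (fun=> 0) = (fun=> 0) :> H.
  by apply/funext => i; rewrite /hlin scaler0 addr0.
by move=> ->; apply/funext => i; rewrite /hlin scaleN1r addNr.
Qed.
Lemma act1 h : act 1 h = h.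
Proof. by rewrite -[1]/(ginj k 1%g : VB) act_ginj -[1%g]/(of_word [::]) act_F2_word. Qed.

Lemma actM v w h : act (v * w) h = act v (act w h).
Proof.
rewrite -[v * w]/(gmul v w).
elim/free_ind: v => [|c g v IHv]; first by rewrite gmul0l !act0l.
rewrite gmul_linl !act_linl {}IHv; congr hlin.
elim/free_ind: w => [|d g' w IHw]; first by rewrite gmul0r act0l act0r.
rewrite gmul_linr !act_linl act_linr {}IHw gmul_delta; congr hlin.
by rewrite -!/(ginj _ _) !act_ginj act_F2M.
Qed.

Lemma actB v w h i : act (v - w) h i = act v h i - act w h i.
Proof. exact: linearB. Qed.

Definition shift (d : int) (h : H) : H := fun i => h (i + d).

Lemma act_X0 h : act (X0 k) h = shift 1 h.
Proof. by rewrite act_ginj act_F2_word. Qed.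
Lemma act_X0V h : act (X0V k) h = shift (-1) h.
Proof. by rewrite act_ginj -[(_^-1)%g]/(fg_inv _) fg_invE act_F2_word. Qed.
Lemma act_X0z i h : act (X0z k i) h = shift i h.
Proof.
elim/int_rect: i => [|n IH|n IH].
- by rewrite act1; apply/funext => j; rewrite /shift addr0.
- rewrite -[n.+1]addn1 PoszD X0zS actM IH act_X0; apply/funext => j.
  by rewrite /shift addrA addrAC.
rewrite -[n.+1]addn1 PoszD opprD X0zP actM IH act_X0V; apply/funext => j.
by rewrite /shift addrA addrAC.
Qed.
Lemma act_X1 h i : act (X1 k - 1) h i = A (gen i) (h 0).
Proof. by rewrite actB act1 act_ginj act_F2_word /= addrC addKr. Qed.

Local Notation diffP := (@diff N P).

(** Constant functions are in [Hfil 0], and evaluation at 0 sends [Hfil m] to F^m.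
    The condition on the differences makes X_0^N - 1, like X_1 - 1, send [Hfil m]
    to [Hfil m.+1]. *)
Definition Hfil m (h : H) := forall n i, fil P (m + n) (iter n diffP h i).

Lemma diff_lin c h h' : diffP (hlin c h h') = hlin c (diffP h) (diffP h').
Proof. by apply/funext => i; rewrite /hlin /diff scalerBr opprD addrACA. Qed.
Lemma iter_diff_lin n c h h' :
  iter n diffP (hlin c h h') = hlin c (iter n diffP h) (iter n diffP h').
Proof. by elim: n => //= n ->; exact: diff_lin. Qed.
Lemma iter_diff_shift n d h : iter n diffP (shift d h) = shift d (iter n diffP h).
Proof.
elim: n => //= n ->; apply/funext => i; rewrite /diff /shift.
by rewrite addrAC.
Qed.
Lemma iter_diff_gen n p i :
  iter n diffP (fun j => A (gen j) p) i = A (iter n (@diff N (WB_filt N k)) gen i) p.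
Proof.
elim: n i => //= n IH i; rewrite /diff !IH.
by have [/(_ p)/linear_sub -> _ _] := fbP A.
Qed.

Lemma Hfil_lin m c h h' : Hfil m h -> Hfil m h' -> Hfil m (hlin c h h').
Proof. by move=> Fh Fh' n i; rewrite iter_diff_lin; apply: smZD. Qed.
Lemma Hfil_shift m d h : Hfil m h -> Hfil m (shift d h).
Proof. by move=> Fh n i; rewrite iter_diff_shift; exact: Fh. Qed.
Lemma Hfil_diff m h : Hfil m h -> Hfil m.+1 (diffP h).
Proof. by move=> Fh n i; rewrite -iterSr addSnnS; exact: Fh. Qed.
Lemma HfilS m h : Hfil m.+1 h -> Hfil m h.
Proof. by move=> Fh n i; apply: filS; exact: Fh. Qed.
Lemma iter_diff_cst n (p : P) : iter n.+1 diffP (fun=> p) = fun=> 0.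
Proof.
elim: n => [|n IH]; last rewrite iterS IH; apply/funext => i; exact: subrr.
Qed.
Lemma Hfil_cst p : Hfil 0 (fun=> p).
Proof.
move=> [|n] i; first exact: fil0.
by rewrite iter_diff_cst; exact: sm0.
Qed.
Lemma Hfil0 m : Hfil m (fun=> 0).
Proof. by move=> [|n] i; rewrite ?iter_diff_cst; exact: sm0. Qed.

(** X_1 - 1 sends [h] to the function of this form with [p = h 0]. *)
Lemma Hfil_gen m p : fil P m p -> Hfil m.+1 (fun i => A (gen i) p).
Proof.
move=> Fp n i; rewrite iter_diff_gen addSnnS addnC.
by apply: fb_fil => //; exact: gen_smooth.
Qed.


Definition hsub (h h' : H) : H := fun i => h i - h' i.
Definition Heq m (h h' : H) := Hfil m (hsub h h').

Lemma hsubE h h' : hsub h h' = hlin (-1) h' h.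
Proof. by apply/funext => i; rewrite /hlin scaleN1r addrC. Qed.
Lemma Heq_refl m h : Heq m h h.
Proof.
rewrite /Heq; have -> : hsub h h = (fun=> 0) by apply/funext => i; exact: subrr.
exact: Hfil0.
Qed.
Lemma Heq_trans m h1 h2 h3 : Heq m h1 h2 -> Heq m h2 h3 -> Heq m h1 h3.
Proof.
move=> F12 F23; rewrite /Heq; have -> : hsub h1 h3 = hlin 1 (hsub h1 h2) (hsub h2 h3).
  by apply/funext => i; rewrite /hlin /hsub scale1r addrA subrK.
exact: Hfil_lin.
Qed.
Lemma Heq_sym m h h' : Heq m h h' -> Heq m h' h.
Proof.
move=> F; rewrite /Heq; have -> : hsub h' h = hlin (-1) (hsub h h') (fun=> 0).
  by apply/funext => i; rewrite /hlin /hsub scaleN1r addr0 opprB.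
exact/Hfil_lin/Hfil0.
Qed.
Lemma Heq_lin m c h1 h2 h1' h2' : Heq m h1 h1' -> Heq m h2 h2' ->
  Heq m (hlin c h1 h2) (hlin c h1' h2').
Proof.
move=> F1 F2; rewrite /Heq.
have -> : hsub (hlin c h1 h2) (hlin c h1' h2') = hlin c (hsub h1 h1') (hsub h2 h2').
  by apply/funext => i; rewrite /hlin /hsub opprD addrACA -scalerBr.
exact: Hfil_lin.
Qed.

Definition letter_deg (l : bool * bool) : int :=
  if l.1 then 0 else if l.2 then -1 else 1.

Lemma act_letter_shift m l h : Hfil m h ->
  Heq m.+1 (act_letter l h) (shift (letter_deg l) h).
Proof.
case: l => [[] e] Fh; last exact: Heq_refl.
have Fh0 : fil P m (h 0) by have := Fh 0%N 0; rewrite addn0.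
have -> : shift (letter_deg (true, e)) h = h.
  by apply/funext => i; rewrite /shift addr0.
case: e; last first.
  rewrite /Heq; have -> : hsub (act_letter (true, false) h) h = fun i => A (gen i) (h 0).
    by apply/funext => i; rewrite /hsub /= addrC addKr.
  exact: Hfil_gen.
apply: Heq_sym.
rewrite /Heq; have -> : hsub h (act_letter (true, true) h) = fun i => A (gen i) (inv (h 0)).
  by apply/funext => i; rewrite /hsub /= subKr.
exact/Hfil_gen/inv_fil.
Qed.

Lemma Hfil_act_letter m l h : Hfil m h -> Hfil m (act_letter l h).
Proof.
move=> Fh; have -> : act_letter l h =
    hlin 1 (hsub (act_letter l h) (shift (letter_deg l) h)) (shift (letter_deg l) h).
  by apply/funext => i; rewrite /hlin /hsub scale1r subrK.
by apply: Hfil_lin; [exact/HfilS/act_letter_shift | exact: Hfil_shift].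
Qed.

(** On the graded pieces of [Hfil], X_1 acts trivially and X_0 by the shift. *)
Lemma act_word_shift m s h : Hfil m h -> Heq m.+1 (act_word s h) (shift (X0_deg s) h).
Proof.
move=> Fh; elim: s => [|l s IH].
  have -> : shift (X0_deg [::]) h = h.
    by apply/funext => i; rewrite /shift /X0_deg big_nil addr0.
  exact: Heq_refl.
have -> : shift (X0_deg (l :: s)) h = shift (letter_deg l) (shift (X0_deg s) h).
  by apply/funext => i; rewrite /shift /X0_deg big_cons addrA.
apply: (@Heq_trans _ _ (act_letter l (shift (X0_deg s) h))); last first.
  exact/act_letter_shift/Hfil_shift.
rewrite /Heq hsubE -act_letter_lin -hsubE; exact: Hfil_act_letter.
Qed.

(** On the graded pieces of [Hfil], the N-th power of X_0 acts trivially. *)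
Lemma shift_mulN m h (d e : int) : Hfil m h -> Heq m.+1 (shift (d + e * N) h) (shift d h).
Proof.
move=> Fh.
have step (d' : int) : Heq m.+1 (shift (d' + N) h) (shift d' h).
  rewrite /Heq; have -> : hsub (shift (d' + N) h) (shift d' h) = diffP (shift d' h).
    by apply/funext => i; rewrite /hsub /diff /shift addrA (addrAC i).
  exact/Hfil_diff/Hfil_shift.
elim/int_rect: e => [|n IH|n IH]; first by rewrite mul0r addr0; exact: Heq_refl.
  rewrite -[n.+1]addn1 PoszD mulrDl mul1r addrA.
  exact: Heq_trans (step _) IH.
apply: Heq_trans IH; apply: Heq_sym.
have -> : d + - n%:Z * N = d + - n.+1%:Z * N + N.
  by rewrite -[n.+1]addn1 PoszD opprD mulrDl mulN1r addrA subrK.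
exact: step.
Qed.

(** The action on a graded piece of [Hfil] factors through the group algebra of
    mu_N; the exponent [r z] represents the root of unity [z]. *)
Lemma act_mod_mu m h : Hfil m h -> exists r : mu N -> int, forall x,
  Heq m.+1 (act x h) (fun i => flift (fun z => shift (r z) h i) (VB_to_mu N x)).
Proof.
move=> Fh.
pose R (z : mu N) := [set d | exists2 s, F2_to_mu N (of_word s) = z & X0_deg s = d]%classic.
exists (fun z => xget 0 (R z)); elim/free_ind => [|c g x IH].
  have -> : act 0 h = (fun i => flift (fun z => shift (xget 0 (R z)) h i) (VB_to_mu N 0)).
    by apply/funext => i; rewrite act0l /VB_to_mu /galg_map !linear0.
  exact: Heq_refl.
rewrite act_linl VB_to_mu_linear.
have -> : (fun i => flift (fun z => shift (xget 0 (R z)) h i)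
                      (c *: VB_to_mu N (delta k g) + VB_to_mu N x)) =
    hlin c (fun i => flift (fun z => shift (xget 0 (R z)) h i) (VB_to_mu N (delta k g)))
           (fun i => flift (fun z => shift (xget 0 (R z)) h i) (VB_to_mu N x)).
  by apply/funext => i; rewrite linearP.
apply: Heq_lin => //; rewrite -/(ginj k g) act_ginj.
elim/freeGroup_ind: g => s; rewrite /VB_to_mu /galg_map flift_delta.
have -> : (fun i => flift (fun z => shift (xget 0 (R z)) h i)
                        (ginj k (F2_to_mu N (of_word s)))) =
    shift (xget 0 (R (F2_to_mu N (of_word s)))) h.
  by apply/funext => i; rewrite flift_delta.
rewrite act_F2_word; apply: Heq_trans (act_word_shift s Fh) _.
case: xgetP => [d _ [t ts <-]|/(_ (X0_deg s))[]]; last by exists s.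
by have [e ->] := X0_deg_congr N_gt0 (esym ts); exact: shift_mulN.
Qed.

Lemma Hfil_augI m x h : augI N k x -> Hfil m h -> Hfil m.+1 (act x h).
Proof.
move=> Ix Fh; have [r /(_ x)] := act_mod_mu Fh; rewrite (Ix : VB_to_mu N x = 0) => F.
suff -> : act x h = hsub (act x h) (fun i => flift (fun z => shift (r z) h i) 0) by [].
by apply/funext => i; rewrite /hsub linear0 subr0.
Qed.

Lemma Hfil_act m j x h : VB_fil N k m x -> Hfil j h -> Hfil (m + j) (act x h).
Proof.
elim: m x j h => [|m IH] x j h.
  move=> _ Fh; elim/free_ind: x => [|c g x IHx]; first by rewrite act0l; exact: Hfil0.
  rewrite act_linl; apply: Hfil_lin => //; rewrite -/(ginj k g) act_ginj.
  by rewrite /act_F2 /act_word; elim: (to_word g) => //= l s; exact: Hfil_act_letter.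
move=> + Fh; elim=> [|c _ v [y z Fy Iz] _ IHv]; first by rewrite act0l; exact: Hfil0.
rewrite act_linl; apply: Hfil_lin => //.
by rewrite actM addSnnS; apply: IH => //; exact: Hfil_augI.
Qed.

Lemma act_recursion (p0 : P) : exists phi : VB -> P,
  [/\ linear phi, phi 1 = p0, forall v, phi (v * (X0 k - 1)) = 0,
      forall m v, VB_fil N k m v -> fil P m (phi v) &
      forall i v, phi (X0z k i * (X1 k - 1) * v) = A (gen i) (phi v)].
Proof.
exists (fun v => act v (fun=> p0) 0); split.
- by move=> c v w; rewrite act_linl.
- by rewrite act1.
- move=> v; rewrite actM.
  have -> : act (X0 k - 1) (fun=> p0) = fun=> 0.
    by apply/funext => i; rewrite actB act1 act_X0 /shift subrr.
  by rewrite act0r.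
- by move=> m v Fv; have := Hfil_act Fv (Hfil_cst p0) 0%N 0; rewrite !addn0.
by move=> i v; rewrite actM actM act_X0z /shift add0r act_X1.
Qed.

End Recursion.

(** The universal property behind both W and M; the vanishing on V (X_0 - 1) is
    what makes it pass to M. *)
Theorem VB_recursion (N : nat) (k : comPzRingType) (P : topMod k)
    (A : fbil (WB_filt N k) P P) (p0 : P) : (0 < N)%N ->
  exists phi : VB k -> P,
  [/\ linear phi, phi 1 = p0, forall v, phi (v * (X0 k - 1)) = 0,
      forall m v, VB_fil N k m v -> fil P m (phi v) &
      forall i v, phi (X0z k i * (X1 k - 1) * v) = A (gen N k i) (phi v)].
Proof.
move=> N_gt0; have gP : lin_deg 1 (A (gen N k 0)).
  have [_ ] := fbP A => /(_ (gen N k 0)) Al AF; split=> // m x Fx.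
  by rewrite addnC -[X in fil _ X]addn0; apply: AF => //; exact: (@gen_smooth N k 0).
have [inv [[inv_lin inv_fil] invr invl]] := geometric_inverse gP.
apply: (act_recursion N_gt0) invr invl p0 => // m x Fx.
by rewrite -[m]addn0; exact: inv_fil.
Qed.

(** * W and M are topologically free on the generators *)

Section Hats.
Variables (N : nat) (k : comPzRingType).
Local Notation VB := (VB k).
Local Notation W := (WB_filt N k).
Local Notation What := (WBhat N k).
Local Notation Mhat := (MBhat N k).

Definition ghat (i : int) : What := to_hat (gen N k i).
Definition Mone : Mhat := to_hat (MB_one k : MB_filt N k).

Lemma WBhat_actA (a b : What) (m : Mhat) :
  WBhat_act N k (ta_mul What a b) m = WBhat_act N k a (WBhat_act N k b m).
Proof.
move: a; apply: hat_ext; [by lin_deg_auto | by lin_deg_auto | move=> a].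
move: b; apply: hat_ext; [by lin_deg_auto | by lin_deg_auto | move=> b].
move: m; apply: hat_ext; [by lin_deg_auto | by lin_deg_auto | move=> m].
by rewrite !hat_bil_to; congr to_hat; exact: WB_actA.
Qed.

Lemma WBhat_act1 (m : Mhat) : WBhat_act N k (ta_one What) m = m.
Proof.
move: m; apply: hat_ext; [by lin_deg_auto | by lin_deg_auto | move=> q].
by rewrite hat_bil_to; congr to_hat; exact: WB_act1.
Qed.

Section Universal.
Hypothesis N_gt0 : (0 < N)%N.
Variables (P : topMod k) (A : fbil What P P) (p0 : P).

Fact restrict_bilP : bilin_deg 0 (fun (w : W) (p : P) => A (to_hat w) p).
Proof.
split=> [p c w w'|w|i j w p Fw Fp]; first by rewrite to_hat_linear fb_linl.
  by move=> c p p'; rewrite fb_linr.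
by rewrite addn0; apply: fb_fil => //; exact: to_hat_fil.
Qed.

Let A0 := Fbil restrict_bilP.

Lemma WBhat_recursion : exists f : filtHom What P,
  f (ta_one What) = p0 /\ forall i x, f (ta_mul What (ghat i) x) = A (ghat i) (f x).
Proof.
have [phi [phi_lin phi1 _ phi_fil phi_gen]] := VB_recursion A0 p0 N_gt0.
pose f (w : W) := phi (WB_val w).
have fP : lin_deg 0 f.
  split=> [c w w'|m w Fw]; first by rewrite /f WB_valZD phi_lin.
  by rewrite addn0; exact: phi_fil.
have hP := hlift_deg fP.
have h_fil m x : fil What m x -> fil P m (hlift f x).
  by move=> /hP.2; rewrite addn0.
pose F : filtHom What P := FiltHom hP.1 h_fil; have FE w : F (to_hat w) = f w := hlift_to w fP.
exists F; split=> [|i x]; first by rewrite FE.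
move: x; apply: hat_ext; [by lin_deg_auto | by lin_deg_auto | move=> w].
by rewrite /ghat hat_bil_to !FE; exact: phi_gen.
Qed.

Lemma MBhat_recursion : exists f : filtHom Mhat P,
  f Mone = p0 /\ forall i m, f (WBhat_act N k (ghat i) m) = A (ghat i) (f m).
Proof.
have [phi [phi_lin phi1 phi_X0 phi_fil phi_gen]] := VB_recursion A0 p0 N_gt0.
pose f (q : MB_filt N k) := phi (rep q).
have fE v : f (MB_cls v) = phi v.
  apply/subr0_eq; rewrite -(linear_sub phi_lin).
  by have [u ->] := rep_cls (VX0_submod k) v.
have fP : lin_deg 0 f.
  split=> [c|m q].
    elim/quo_ind=> v; elim/quo_ind=> w.
    by rewrite -linearP -!/(MB_cls _) !fE phi_lin.
  by move=> /MB_filP[w Fw ->]; rewrite fE addn0; exact: phi_fil.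
have hP := hlift_deg fP.
have h_fil m x : fil Mhat m x -> fil P m (hlift f x).
  by move=> /hP.2; rewrite addn0.
pose F : filtHom Mhat P := FiltHom hP.1 h_fil; have FE q : F (to_hat q) = f q := hlift_to q fP.
exists F; split=> [|i x]; first by rewrite FE fE.
move: x; apply: hat_ext; [by lin_deg_auto | by lin_deg_auto | move=> q].
rewrite /ghat hat_bil_to !FE; elim/quo_ind: q => v.
rewrite -[cls _ v]/(MB_cls v) /= /WB_act VB_actE !fE; exact: phi_gen.
Qed.

End Universal.

(** [U] is the set of v in V congruent modulo I^m to a combination of elements
    y_i w with w in [S].  It is a left ideal containing X_1 - 1, so it contains
    V (X_1 - 1). *)
Lemma WB_dense (S : submod W) :
    S (WB_one N k) -> (forall i w, S w -> S (WB_mul (gen N k i) w)) ->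
  forall m w, exists2 w', S w' & WB_fil N k m (w - w').
Proof.
move=> S1 Sgen m.
pose T := lspan (fun t : W => exists i w, S w /\ t = WB_mul (gen N k i) w).
have TS t : T t -> S t by apply: lspan_min => _ [i [w [Sw ->]]]; exact: Sgen.
have Tgen i w : S w -> T (WB_mul (gen N k i) w) by move=> Sw; apply: lspan_gen; exists i, w.
have U_subproof : is_submod (fun v : VB => exists2 t, T t & VB_fil N k m (v - WB_val t)).
  split=> [|c v v' [t Tt vt] [t' Tt' vt']].
    by exists 0; [exact: sm0 | rewrite sub0r; apply: smN; exact: sm0].
  exists (c *: t + t'); first exact: smZD.
  by rewrite WB_valZD opprD addrACA -scalerBr; exact: smZD.
pose U := Submod U_subproof.
have U_mul (a v : VB) : (forall t, T t -> U (a * WB_val t)) -> U v -> U (a * v).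
  move=> aT [t Tt vt]; have [t' Tt' at'] := aT t Tt; exists t' => //.
  rewrite -(subrK (a * WB_val t) (a * v)) -addrA; apply: smD => //.
  by rewrite -mulrBr -[m]add0n; exact: VB_fil_mul.
have T_X0 (a : VB) : (forall i, exists j, a * X0z k i = X0z k j) ->
    forall t, T t -> U (a * WB_val t).
  move=> aX t; elim=> [|c _ u [i [w [Sw ->]]] _ IH].
    by rewrite mulr0; exact: sm0.
  rewrite WB_valZD VB_mulZDr; apply: smZD => //; have [j aij] := aX i.
  exists (WB_mul (gen N k j) w); first exact: Tgen.
  rewrite /WB_val /= !mulrA aij subrr; exact: sm0.
have U_y (v : VB) : U v -> U ((X1 k - 1) * v).
  apply: U_mul => t /TS St; exists (WB_mul (gen N k 0) t); first exact: Tgen.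
  by rewrite /WB_val /= mul1r subrr; exact: sm0.
have U_F v : VB_fil N k m v -> U v.
  by move=> Fv; exists 0; [exact: sm0 | rewrite subr0].
have F_y n : VB_fil N k n ((X1 k - 1) ^+ n).
  elim: n => // n IH; rewrite exprSr.
  by apply: lspan_gen; apply: ProdSet => //; exact: augI_X1.
(* X_1^-1 = 1 - X_1^-1 (X_1 - 1), iterated until the power of X_1 - 1 is in I^m. *)
have U_X1V (v : VB) : U v -> U (X1V k * v).
  move=> Uv; suff H n : (n <= m)%N -> U (X1V k * ((X1 k - 1) ^+ (m - n) * v)).
    by have := H m (leqnn m); rewrite subnn expr0 mul1r.
  elim: n => [|n IH] nm.
    rewrite subn0; apply: U_F; rewrite -[m]add0n; apply: VB_fil_mul => //.
    exact: VB_fil_mulr.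
  have -> : X1V k = 1 - X1V k * (X1 k - 1) by rewrite mulrBr mulr1 X1K opprB addrC subrK.
  rewrite mulrBl mul1r -mulrA; apply: smB; last first.
    rewrite [_ * (_ * v)]mulrA -exprS -subSn // subSS; exact/IH/ltnW.
  by elim: (m - n.+1)%N => [|j IHj]; rewrite ?mul1r // exprS -mulrA; exact: U_y.
have U_X1 (v : VB) : U v -> U (X1 k * v).
  by move=> Uv; rewrite -[X1 k](subrK 1) mulrDl mul1r; apply: smD => //; exact: U_y.
have U_V (v u : VB) : U u -> U (v * u).
  move=> Uu; elim/free_ind: v => [|c g v IH]; first by rewrite mul0r; exact: sm0.
  rewrite VB_mulZDl; apply: smZD => //.
  elim/freeGroup_ind: g => s; elim: s => [|[x e] s IHs]; first by rewrite mul1r.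
  have -> : delta k (of_word ((x, e) :: s)) =
      (ginj k (of_word [:: (x, e)] : F2) : VB) * delta k (of_word s).
    by rewrite -ginjM [(_ * _)%g]fg_mulE.
  rewrite -mulrA; case: x e => [] [].
  - have -> : of_word [:: (true, true)] = (fg_gen true)^-1%g by rewrite [RHS]fg_invE.
    exact: U_X1V.
  - exact: U_X1.
  - have -> : of_word [:: (false, true)] = (fg_gen false)^-1%g by rewrite [RHS]fg_invE.
    by apply: U_mul => //; apply: T_X0 => i; exists (i - 1); rewrite X0zP.
  by apply: U_mul => //; apply: T_X0 => i; exists (i + 1); rewrite X0zS.
move=> w; have [c [v vE]] : WB_set (WB_val w) := submP w.
have U_1 : U (X1 k - 1).
  exists (WB_mul (gen N k 0) (WB_one N k)); first exact: Tgen.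
  by rewrite /WB_val /= mulr1 mul1r subrr; exact: sm0.
have [t Tt vt] := U_V v _ U_1.
exists (c *: WB_one N k + t); first by apply: smZD => //; exact: TS.
suff: VB_fil N k m (WB_val w - WB_val (c *: WB_one N k + t)) by rewrite /WB_val -subm_valB.
by rewrite WB_valZD vE opprD addrACA subrr add0r.
Qed.

Lemma WBhat_ext (P : topMod k) s t (f g : What -> P) :
    lin_deg s f -> lin_deg t g -> f (ta_one What) = g (ta_one What) ->
    (forall i x, f x = g x -> f (ta_mul What (ghat i) x) = g (ta_mul What (ghat i) x)) ->
  f =1 g.
Proof.
move=> fP gP fg1 fg_gen; apply: (hat_ext fP gP) => w.
have S_subproof : is_submod (fun w : W => f (to_hat w) = g (to_hat w)).
  split=> [|c x y Ex Ey]; last by rewrite to_hat_linear fP.1 gP.1 Ex Ey.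
  by rewrite (lin_raw (@to_hat_linear _ W)) (lin_raw fP.1) (lin_raw gP.1).
apply: (lin_deg_eq_approx fP gP) => m.
have [//|i x Sx|w' Sw' ww'] := @WB_dense (Submod S_subproof) _ _ m w.
  by have := fg_gen i (to_hat x) Sx; rewrite hat_bil_to.
by exists (to_hat w') => //; rewrite -(linear_sub (@to_hat_linear _ W)); exact: to_hat_fil.
Qed.

(** M is the cyclic module W 1_B, by the decomposition V = W + V (X_0 - 1). *)
Lemma MBhat_ext (P : topMod k) s t (f g : Mhat -> P) :
    lin_deg s f -> lin_deg t g -> f Mone = g Mone ->
    (forall i m, f m = g m -> f (WBhat_act N k (ghat i) m) = g (WBhat_act N k (ghat i) m)) ->
  f =1 g.
Proof.
move=> fP gP fg1 fg_gen; apply: (hat_ext fP gP); elim/quo_ind=> v.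
have [w _ vw] := VB_decomp v.
have -> : to_hat (cls (VX0_submod k) v : MB_filt N k) = WBhat_act N k (to_hat (w : W)) Mone.
  rewrite hat_bil_to; congr to_hat.
  by rewrite /= /WB_act VB_actE mulr1; apply/clsP.
have actP : lin_deg 0 (fun x : What => WBhat_act N k x Mone) by lin_deg_auto.
apply: (WBhat_ext (lin_deg_comp actP fP) (lin_deg_comp actP gP)) => [|i x].
  by rewrite !WBhat_act1.
by rewrite !WBhat_actA; exact: fg_gen.
Qed.

End Hats.

(** * Primitive operators on completed tensor products *)

Section Operators.
Variable k : comPzRingType.

Lemma ctDl (A B : filtMod k) (x x' : A) (y : B) : ct (x + x') y = ct x y + ct x' y.
Proof. by case: (@ct_deg k A B) => /(_ y)/lin_raw l _ _; rewrite l. Qed.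
Lemma ctDr (A B : filtMod k) (x : A) (y y' : B) : ct x (y + y') = ct x y + ct x y'.
Proof. by case: (@ct_deg k A B) => _ /(_ x)/lin_raw l _; rewrite l. Qed.
Lemma ct0l (A B : filtMod k) (y : B) : ct (0 : A) y = 0.
Proof. by case: (@ct_deg k A B) => /(_ y)/lin_raw l _ _; rewrite l. Qed.
Lemma ct0r (A B : filtMod k) (x : A) : ct x (0 : B) = 0.
Proof. by case: (@ct_deg k A B) => _ /(_ x)/lin_raw l _; rewrite l. Qed.
Lemma hom_idE (A : filtMod k) (x : A) : hom_id A x = x.
Proof. by []. Qed.
Lemma homD (A B : filtMod k) (f : filtHom A B) x y : f (x + y) = f x + f y.
Proof. by rewrite (lin_raw (hom_linear f)). Qed.
Lemma fbDl (A B C : filtMod k) (b : fbil A B C) x x' y : b (x + x') y = b x y + b x' y.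
Proof. by case: (fbP b) => /(_ y)/lin_raw l _ _; rewrite l. Qed.

Definition lmulop (A B C : filtMod k) (b : fbil A B C) (x : A) : filtHom B C.
Proof.
apply: (@FiltHom k B C (b x)) => [|m y Fy]; first by case: (fbP b) => _ + _; apply.
by rewrite -[m]add0n; apply: fb_fil => //; exact: fil0.
Defined.

Definition zero_op (A B : filtMod k) : filtHom A B.
Proof.
apply: (@FiltHom k A B (fun=> 0)) => [c x y|m x _]; first by rewrite scaler0 addr0.
exact: sm0.
Defined.

(** f (x) 1 + 1 (x) g, the action of a primitive element when [f] and [g] are its
    actions on the factors. *)
Definition dsum (A B : filtMod k) (f : filtHom A A) (g : filtHom B B) :
  filtHom (ctens A B) (ctens A B).
Proof.
apply: (@FiltHom k _ _ (fun t => ct_map f (hom_id B) t + ct_map (hom_id A) g t)).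
  by move=> c x y; rewrite !hom_linear scalerDr addrACA.
by move=> m x Fx; apply: smD; exact: hom_fil.
Defined.

Lemma dsumE (A B : filtMod k) (f : filtHom A A) (g : filtHom B B) a b :
  dsum f g (ct a b) = ct (f a) b + ct a (g b).
Proof. by rewrite -[LHS]/(ct_map f (hom_id B) _ + ct_map (hom_id A) g _) !ct_mapE. Qed.

(** Applied to Delta, eps and S, whose behaviour on left multiplications is known,
    this computes the operators on tensor squares occurring in the axioms. *)
Lemma ct_map_dsum (A A' B B' : filtMod k) (f : filtHom A A') (g : filtHom B B')
    (a : filtHom A A) (b : filtHom B B) (a' : filtHom A' A') (b' : filtHom B' B') :
    (forall x, f (a x) = a' (f x)) -> (forall y, g (b y) = b' (g y)) ->
  forall t, ct_map f g (dsum a b t) = dsum a' b' (ct_map f g t).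
Proof.
move=> fa gb; apply: ctens_ext; [by lin_deg_auto | by lin_deg_auto | move=> x y].
by rewrite ct_mapE !dsumE homD !ct_mapE fa gb.
Qed.

Lemma ct_swap_dsum (A B : filtMod k) (a : filtHom A A) (b : filtHom B B) t :
  ct_swap A B (dsum a b t) = dsum b a (ct_swap A B t).
Proof.
move: t; apply: ctens_ext; [by lin_deg_auto | by lin_deg_auto | move=> x y].
by rewrite ct_swapE !dsumE homD !ct_swapE addrC.
Qed.

Lemma ct_assoc_dsum (A B C : filtMod k)
    (a : filtHom A A) (b : filtHom B B) (c : filtHom C C) t :
  ct_assoc A B C (dsum (dsum a b) c t) = dsum a (dsum b c) (ct_assoc A B C t).
Proof.
move: t; apply: ctens_ext; [by lin_deg_auto | by lin_deg_auto | move=> s z].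
rewrite dsumE; move: s; apply: ctens_ext; [by lin_deg_auto | by lin_deg_auto | move=> x y].
rewrite ct_assocE !dsumE ctDl ctDr !homD !ct_assocE.
by rewrite addrA.
Qed.

Lemma ct_unitl_dsum (A : topMod k) (a : filtHom A A) t :
  ct_unitl A (dsum (zero_op (unit_obj k) (unit_obj k)) a t) = a (ct_unitl A t).
Proof.
move: t; apply: ctens_ext; [by lin_deg_auto | by lin_deg_auto | move=> c x].
rewrite dsumE ct0l add0r !ct_unitlE.
by rewrite (lin_raw (hom_linear a)).
Qed.

Lemma ct_unitr_dsum (A : topMod k) (a : filtHom A A) t :
  ct_unitr A (dsum a (zero_op (unit_obj k) (unit_obj k)) t) = a (ct_unitr A t).
Proof.
move: t; apply: ctens_ext; [by lin_deg_auto | by lin_deg_auto | move=> x c].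
rewrite dsumE ct0r addr0 !ct_unitrE.
by rewrite (lin_raw (hom_linear a)).
Qed.

(** [M_ext] is the uniqueness half of freeness: filtered maps on [M] are
    determined by their value at [u] and their behaviour under the operators
    [a i], which act on [M (x) M] as primitive elements do. *)
Section CyclicCoalgebra.
Variables (M : topMod k) (I : Type) (a : I -> filtHom M M) (u : M).
Hypothesis M_ext : forall (P : topMod k) s t (f g : M -> P),
  lin_deg s f -> lin_deg t g -> f u = g u ->
  (forall i x, f x = g x -> f (a i x) = g (a i x)) -> f =1 g.
Variables (Delta : filtHom M (ctens M M)) (eps : filtHom M (unit_obj k)).
Hypothesis Delta_u : Delta u = ct u u.
Hypothesis Delta_a : forall i x, Delta (a i x) = dsum (a i) (a i) (Delta x).
Hypothesis eps_u : eps u = (1 : k).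
Hypothesis eps_a : forall i x, eps (a i x) = 0.

Lemma cyclic_coalg : is_coalg Delta eps.
Proof.
split.
- apply: M_ext; [by lin_deg_auto | by lin_deg_auto | | move=> i x E].
    by rewrite Delta_u 2!ct_mapE !(@hom_idE M) Delta_u ct_assocE.
  have El : ct_map Delta (hom_id M) (dsum (a i) (a i) (Delta x)) =
      dsum (dsum (a i) (a i)) (a i) (ct_map Delta (hom_id M) (Delta x)).
    exact (@ct_map_dsum _ _ _ _ Delta (hom_id M) (a i) (a i) (dsum (a i) (a i)) (a i)
      (Delta_a i) (fun=> erefl) (Delta x)).
  have Er : ct_map (hom_id M) Delta (dsum (a i) (a i) (Delta x)) =
      dsum (a i) (dsum (a i) (a i)) (ct_map (hom_id M) Delta (Delta x)).
    exact (@ct_map_dsum _ _ _ _ (hom_id M) Delta (a i) (a i) (a i) (dsum (a i) (a i))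
      (fun=> erefl) (Delta_a i) (Delta x)).
  rewrite Delta_a; apply: etrans (congr1 (ct_assoc M M M) El) _.
  apply: etrans (ct_assoc_dsum _ _ _ _) _.
  exact: etrans (congr1 (dsum (a i) (dsum (a i) (a i))) E) (esym Er).
- apply: M_ext; [by lin_deg_auto | by lin_deg_auto | | move=> i x E].
    by rewrite Delta_u ct_swapE.
  by rewrite Delta_a ct_swap_dsum E.
- apply: M_ext; [by lin_deg_auto | by lin_deg_auto | | move=> i x E].
    by rewrite Delta_u ct_mapE hom_idE ct_unitlE eps_u scale1r.
  rewrite Delta_a (@ct_map_dsum _ _ _ _ eps (hom_id M) _ _ (zero_op _ _) (a i)) //.
  by rewrite ct_unitl_dsum E.
apply: M_ext; [by lin_deg_auto | by lin_deg_auto | | move=> i x E].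
  by rewrite Delta_u ct_mapE hom_idE ct_unitrE eps_u scale1r.
rewrite Delta_a (@ct_map_dsum _ _ _ _ (hom_id M) eps _ _ (a i) (zero_op _ _)) //.
by rewrite ct_unitr_dsum E.
Qed.
End CyclicCoalgebra.

Section Primitive.
Variables (A : topAlg k) (M : filtMod k) (act : fbil A M M).
Hypothesis act1 : forall m, act (ta_one A) m = m.

Definition prim_op (a : A) : ctens A A := ct a (ta_one A) + ct (ta_one A) a.

Fact prim_bilP : bilin_deg 0 (fun a (t : ctens M M) => ct_bil act act (prim_op a) t).
Proof.
have prim_deg : lin_deg 0 prim_op by rewrite /prim_op; lin_deg_auto.
split=> [t c a a'|a c t t'|i j a t Fa Ft].
- by rewrite prim_deg.1 fb_linl.
- by rewrite fb_linr.
by rewrite addn0; apply: fb_fil => //; have := prim_deg.2 _ _ Fa; rewrite addn0.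
Qed.
Definition prim_bil := Fbil prim_bilP.

Lemma prim_bilE a t : prim_bil a t = dsum (lmulop act a) (lmulop act a) t.
Proof.
move: t; apply: ctens_ext; [by lin_deg_auto | by lin_deg_auto | move=> m m'].
by rewrite dsumE -[LHS]/(ct_bil act act (prim_op a) _) /prim_op fbDl !ct_bilE !act1.
Qed.

Lemma ct_bil1 t : ct_bil act act (ct (ta_one A) (ta_one A)) t = t.
Proof.
move: t; apply: ctens_ext; [by lin_deg_auto | by lin_deg_auto | move=> m m'].
by rewrite ct_bilE !act1.
Qed.

Hypothesis actA : forall a b m, act (ta_mul A a b) m = act a (act b m).

Lemma ct_bil_dsum a s t :
  ct_bil act act (dsum (lmulop (ta_mul A) a) (lmulop (ta_mul A) a) s) t =
  dsum (lmulop act a) (lmulop act a) (ct_bil act act s t).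
Proof.
move: s; apply: ctens_ext; [by lin_deg_auto | by lin_deg_auto | move=> x y].
rewrite dsumE fbDl.
move: t; apply: ctens_ext; [by lin_deg_auto | by lin_deg_auto | move=> m m'].
by rewrite !ct_bilE dsumE /= !actA.
Qed.
End Primitive.

Section Antipode.
Variable A : topAlg k.

(** For a primitive, S(a) = - a, so S(a x) = - S(x) a since S reverses products. *)
Definition neg_rmul (x a : A) : A := - ta_mul A x a.
Fact anti_bilP : bilin_deg 0 (fun a x : A => neg_rmul x a).
Proof.
split=> [x c a a'|a c x x'|i j a x Fa Fx].
- by rewrite /neg_rmul fb_linr opprD scalerN.
- by rewrite /neg_rmul fb_linl opprD scalerN.
by rewrite addn0 addnC; apply: smN; apply: fb_fil.
Qed.
Definition anti_bil := Fbil anti_bilP.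

Lemma mul_dsum_l a t :
  ctlift_hom (ta_mul A) (dsum (lmulop anti_bil a) (lmulop (ta_mul A) a) t) = 0.
Proof.
move: t; apply: (ctens_ext (g := fun=> 0)).
- by lin_deg_auto.
- exact: (lin_deg_hom (zero_op A A) (lin_deg_hom (ctlift_hom (ta_mul A)) (lin_deg_id _))).
move=> x y; rewrite dsumE homD !ctlift_homE /= /neg_rmul.
have [/(_ y)/lin_raw l _ _] := fbP (ta_mul A).
by rewrite -scaleN1r l scaleN1r (alg_mulA (ta_alg A)) addNr.
Qed.

(** On multiples of 1 the right-hand side vanishes, which is how the right
    antipode identity propagates from x to a x. *)
Lemma mul_dsum_r a t :
  ctlift_hom (ta_mul A) (dsum (lmulop (ta_mul A) a) (lmulop anti_bil a) t) =
  ta_mul A a (ctlift_hom (ta_mul A) t) - ta_mul A (ctlift_hom (ta_mul A) t) a.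
Proof.
move: t; apply: ctens_ext; [by lin_deg_auto | by lin_deg_auto | move=> x y].
rewrite dsumE homD !ctlift_homE /= /neg_rmul.
have [_ /(_ x)/lin_raw r _] := fbP (ta_mul A).
by rewrite -[- ta_mul A y a]scaleN1r r scaleN1r !(alg_mulA (ta_alg A)).
Qed.
End Antipode.

(** * Hopf algebras with primitive generators *)

(** [A_ext] expresses that the products of the [g i] span a dense submodule of [A]. *)
Section PrimitiveHopf.
Variables (A : topAlg k) (I : Type) (g : I -> A).
Local Notation one := (ta_one A).
Local Notation mul := (ta_mul A).
Let L i : filtHom A A := lmulop mul (g i).
Hypothesis A_ext : forall (P : topMod k) s t (f h : A -> P),
  lin_deg s f -> lin_deg t h -> f one = h one ->
  (forall i x, f x = h x -> f (L i x) = h (L i x)) -> f =1 h.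
Variables (Delta : filtHom A (ctens A A)) (eps : filtHom A (unit_obj k)) (S : filtHom A A).
Hypothesis Delta_1 : Delta one = ct one one.
Hypothesis Delta_g : forall i x, Delta (L i x) = dsum (L i) (L i) (Delta x).
Hypothesis eps_1 : eps one = (1 : k).
Hypothesis eps_g : forall i x, eps (L i x) = 0.
Hypothesis S_1 : S one = one.
Hypothesis S_g : forall i x, S (L i x) = lmulop (anti_bil A) (g i) (S x).

Let mul1 := alg_mul1l (ta_alg A).
Let mulA x y z : mul (mul x y) z = mul x (mul y z).
Proof. exact/esym/(alg_mulA (ta_alg A)). Qed.

(** Both sides, as functions of [a], are intertwined with [g i] by the primitive
    operator on M (x) M.  For [M = A] this is the multiplicativity of [Delta]. *)
Lemma primitive_act (M : filtMod k) (act : fbil A M M) (DeltaM : filtHom M (ctens M M)) :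
    (forall m, act one m = m) -> (forall a b m, act (mul a b) m = act a (act b m)) ->
    (forall i m, DeltaM (act (g i) m) =
                 dsum (lmulop act (g i)) (lmulop act (g i)) (DeltaM m)) ->
  forall a m, DeltaM (act a m) = ct_bil act act (Delta a) (DeltaM m).
Proof.
move=> act1 actA DeltaM_g a m; move: a.
apply: A_ext; [by lin_deg_auto | by lin_deg_auto | | move=> i x E].
  by rewrite Delta_1 (ct_bil1 act1) act1.
by rewrite Delta_g (ct_bil_dsum actA) -E -DeltaM_g /= actA.
Qed.

(* c, x |-> c x, written as a bilinear map so that [A_ext] applies. *)
Let scale_bil := Fbil (unit_lP A).

Lemma antipode_l a :
  ctlift_hom mul (ct_map S (hom_id A) (Delta a)) = scale_bil (eps a) one.
Proof.
move: a; apply: A_ext; [by lin_deg_auto | by lin_deg_auto | | move=> i x E].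
  by rewrite Delta_1 ct_mapE S_1 ctlift_homE mul1 eps_1 /= scale1r.
have Es : ct_map S (hom_id A) (dsum (L i) (L i) (Delta x)) =
    dsum (lmulop (anti_bil A) (g i)) (L i) (ct_map S (hom_id A) (Delta x)).
  exact (@ct_map_dsum _ _ _ _ S (hom_id A) (L i) (L i) _ (L i)
           (S_g i) (fun=> erefl) (Delta x)).
rewrite Delta_g eps_g [RHS]/= scale0r.
apply: etrans (congr1 (ctlift_hom mul) Es) _.
exact (mul_dsum_l (g i) (ct_map S (hom_id A) (Delta x))).
Qed.

Lemma antipode_r a :
  ctlift_hom mul (ct_map (hom_id A) S (Delta a)) = scale_bil (eps a) one.
Proof.
move: a; apply: A_ext; [by lin_deg_auto | by lin_deg_auto | | move=> i x E].
  by rewrite Delta_1 ct_mapE S_1 ctlift_homE mul1 eps_1 /= scale1r.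
have Es : ct_map (hom_id A) S (dsum (L i) (L i) (Delta x)) =
    dsum (L i) (lmulop (anti_bil A) (g i)) (ct_map (hom_id A) S (Delta x)).
  exact (@ct_map_dsum _ _ _ _ (hom_id A) S (L i) (L i) (L i) _
           (fun=> erefl) (S_g i) (Delta x)).
rewrite Delta_g eps_g [RHS]/= scale0r.
apply: etrans (congr1 (ctlift_hom mul) Es) _.
apply: etrans (mul_dsum_r (g i) _) _; rewrite E.
have [/(_ (g i))/lin_raw l /(_ (g i))/lin_raw r _] := fbP mul.
by rewrite /= l r mul1 (alg_mul1r (ta_alg A)) subrr.
Qed.

Lemma primitive_hopf : is_hopf Delta eps S.
Proof.
split.
- exact: (@cyclic_coalg A I L one A_ext).
- by split=> // a b; apply: (primitive_act mul1 mulA).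
- exact: eps_1.
- move=> a b; rewrite -[RHS]/(Fbil (unit_lP (unit_obj k)) (eps a) (eps b)); move: a.
  apply: A_ext; [by lin_deg_auto | by lin_deg_auto | | move=> i x E].
    by rewrite mul1 eps_1 /= scale1r.
  rewrite [in RHS]eps_g [RHS]/= scale0r -[L i x]/(mul (g i) x) mulA.
  exact: eps_g.
- exact: antipode_l.
exact: antipode_r.
Qed.
End PrimitiveHopf.

Fact zero_bilP (A B C : filtMod k) : bilin_deg 0 (fun (_ : A) (_ : B) => 0 : C).
Proof.
split=> [y c x x'|x c y y'|i j x y _ _]; [| |exact: sm0].
  by rewrite scaler0 addr0.
by rewrite scaler0 addr0.
Qed.
Definition zero_bil (A B C : filtMod k) := Fbil (@zero_bilP A B C).

End Operators.

(** * Completed W and M *)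

Theorem mainTheorem2 (N : nat) (hN : (1 <= N)%N) (k : comPzRingType)
    (iota : {rmorphism rat -> k}) :
  exists (DeltaW : filtHom (WBhat N k) (ctens (WBhat N k) (WBhat N k)))
         (DeltaM : filtHom (MBhat N k) (ctens (MBhat N k) (MBhat N k))),
  [/\ hopf_algebra DeltaW,
      coalgebra DeltaM &
      forall (a : WBhat N k) (m : MBhat N k),
        DeltaM (WBhat_act N k a m) =
        ct_bil (WBhat_act N k) (WBhat_act N k) (DeltaW a) (DeltaM m)].
Proof.
pose W := WBhat N k; pose M := MBhat N k; pose one : W := ta_one W; pose oneM : M := Mone N k.
pose zero_act := zero_bil W (unit_obj k) (unit_obj k).
have mul1 : forall x : W, ta_mul W one x = x := alg_mul1l (ta_alg W).
have act1 := @WBhat_act1 N k; have actA := @WBhat_actA N k.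
have [DeltaW [DW1 DWg]] := WBhat_recursion hN (prim_bil (ta_mul W)) (ct one one).
have [DeltaM [DM1 DMg]] := MBhat_recursion hN (prim_bil (WBhat_act N k)) (ct oneM oneM).
have [S [S1 Sg]] := WBhat_recursion hN (anti_bil W) one.
have [epsW [eW1 eWg]] := WBhat_recursion hN zero_act (1 : k).
have [epsM [eM1 eMg]] := MBhat_recursion hN zero_act (1 : k).
pose LM i : filtHom M M := lmulop (WBhat_act N k) (ghat N k i).
have DWg' i x := etrans (DWg i x) (prim_bilE mul1 _ _).
have DMg' i m : DeltaM (LM i m) = dsum (LM i) (LM i) (DeltaM m).
  exact: etrans (DMg i m) (prim_bilE act1 _ _).
exists DeltaW, DeltaM; split.
- by exists epsW, S; exact: (primitive_hopf (@WBhat_ext N k) DW1 DWg' eW1 eWg S1 Sg).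
- by exists epsM; exact: (@cyclic_coalg k M int LM oneM (@MBhat_ext N k) _ _ DM1 DMg' eM1 eMg).
exact: (primitive_act (@WBhat_ext N k) DW1 DWg' act1 actA DMg').
Qed.
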